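(* Let $\mu$ be a generating, finitely supported probability measure on the positive semigroup $\mathrm{Br}_3^+$, and let $w_n=g_1\cdots g_n$ be the random walk driven by $\mu$ (the $g_i$ being independent with law $\mu$). Let $K$ be a compact set contained in $\{t\in\mathbb{D} : \lambda(t)<0\}$. Then for almost every sample path $(w_n)$, $$\lim_{n\to\infty}\frac1n\,\#\{t\in K : \Delta_{\widehat{w}_n}(t)=0\}=\nu_{\mathrm{bif}}(K)=0,$$ where roots are counted with multiplicity.
   Context: $\mathrm{Br}_3 = \langle \sigma_1, \sigma_2 \mid \sigma_1\sigma_2\sigma_1 = \sigma_2\sigma_1\sigma_2\rangle$ is the 3-strand braid group; $\mathrm{Br}_3^+$ is its semigroup of positive braids (nonempty products of $\sigma_1,\sigma_2$); $\mu$ is generating if the semigroup generated by its support is $\mathrm{Br}_3^+$. The reduced Burau representation $B_t : \mathrm{Br}_3 \to \mathrm{GL}_2(\mathbb{Z}[t^{\pm1}])$ is given by $B_t(\sigma_1) = \begin{pmatrix} -t & 1\\ 0 & 1\end{pmatrix}$, $B_t(\sigma_2) = \begin{pmatrix} 1 & 0 \\ t & -t\end{pmatrix}$. For $w\in\mathrm{Br}_3$, with braid closure $\widehat{w}$, the Alexander polynomial is $\Delta_{\widehat{w}}(t)=\det(B_t(w)-I)/(t^2+t+1)$, well defined up to units $\pm t^k$; by convention $0$ is a root of $\Delta_{\widehat w}$ only if $\Delta_{\widehat w}=0$. The Lyapunov exponent is $\lambda(t)=\lim_{n\to\infty}\frac1n\int\log\|B_t(g)\|\,d\mu^{*n}(g)\in[-\infty,\infty)$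 for $t\in\mathbb{C}$, with $\|\cdot\|$ any matrix norm. Write $\log^+x=\max\{0,\log x\}$ and $\chi(t)=\max\{\lambda(t),\log^+|t|\}$. The bifurcation measure is $\nu_{\mathrm{bif}}=\frac1{2\pi}dd^c\chi$, where $dd^c$ is the usual (distributional) Laplacian on $\mathbb{C}=\mathbb{R}^2$. $\mathbb{D}$ is the open unit disc. *)

(* Defs.v *)
From HB Require Import structures.
From mathcomp Require Import all_boot all_order all_algebra generic_quotient.
From mathcomp Require Import all_classical all_reals all_analysis.
From mathcomp Require Import finmap ring.
From mathcomp Require Import complex.

Set Implicit Arguments.
Unset Strict Implicit.
Unset Printing Implicit Defensive.

Import Order.TTheory GRing.Theory Num.Theory.
Import numFieldNormedType.Exports.

Local Open Scope quotient_scope.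
Local Open Scope classical_set_scope.
Local Open Scope ring_scope.

(* A letter [(i, e)] stands for [sigma_1] ([i = false]) or [sigma_2]
   ([i = true]), inverted when [e = true]. *)
Definition braid_word := seq (bool * bool).

Inductive braid_eq : braid_word -> braid_word -> Prop :=
| braid_eq_refl u : braid_eq u u
| braid_eq_sym u v : braid_eq u v -> braid_eq v u
| braid_eq_trans u v w : braid_eq u v -> braid_eq v w -> braid_eq u w
| braid_eq_cancel u v i e : braid_eq (u ++ [:: (i, e); (i, ~~ e)] ++ v) (u ++ v)
| braid_eq_braid u v :
    braid_eq (u ++ [:: (false, false); (true, false); (false, false)] ++ v)
             (u ++ [:: (true, false); (false, false); (true, false)] ++ v).

Definition braid_eqb (u v : braid_word) : bool := `[< braid_eq u v >].

Lemma braid_eqb_refl : reflexive braid_eqb.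
Proof. by move=> u; apply/asboolP; exact: braid_eq_refl. Qed.

Lemma braid_eqb_sym : symmetric braid_eqb.
Proof. by move=> u v; apply/asboolP/asboolP; exact: braid_eq_sym. Qed.

Lemma braid_eqb_trans : transitive braid_eqb.
Proof.
move=> v u w /asboolP uv /asboolP vw; apply/asboolP.
exact: braid_eq_trans uv vw.
Qed.

Canonical braid_equiv :=
  EquivRel braid_eqb braid_eqb_refl braid_eqb_sym braid_eqb_trans.

Definition Br3 := {eq_quot braid_equiv}.
HB.instance Definition _ := EqQuotient.on Br3.
HB.instance Definition _ := Choice.on Br3.
HB.instance Definition _ := Countable.copy Br3 (can_type (@reprK _ Br3)).

Definition braid_of (u : braid_word) : Br3 := \pi_Br3 u.

Lemma braid_ofP u v : braid_of u = braid_of v <-> braid_eq u v.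
Proof. by split=> [/eqmodP/asboolP|h]//; apply/eqmodP/asboolP. Qed.

Lemma repr_braid_of u : braid_eq (repr (braid_of u)) u.
Proof. by apply/braid_ofP; rewrite /braid_of reprK. Qed.

Lemma braid_eq_ctx a b u v : braid_eq u v -> braid_eq (a ++ u ++ b) (a ++ v ++ b).
Proof.
elim=> [w|? ? _|? w ? _ + _|u' v' i e|u' v'].
- exact: braid_eq_refl.
- exact: braid_eq_sym.
- exact: braid_eq_trans.
- by have := braid_eq_cancel (a ++ u') (v' ++ b) i e; rewrite -!catA.
- by have := braid_eq_braid (a ++ u') (v' ++ b); rewrite -!catA.
Qed.

Lemma braid_eq_cat u u' v v' :
  braid_eq u u' -> braid_eq v v' -> braid_eq (u ++ v) (u' ++ v').
Proof.
move=> /(braid_eq_ctx [::] v) uu' /(braid_eq_ctx u' [::]).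
by rewrite !cats0; exact: braid_eq_trans.
Qed.

Definition word_inv (u : braid_word) : braid_word :=
  rev [seq (l.1, ~~ l.2) | l <- u].

Lemma word_inv_cat u v : word_inv (u ++ v) = word_inv v ++ word_inv u.
Proof. by rewrite /word_inv map_cat rev_cat. Qed.

Lemma word_invK : involutive word_inv.
Proof.
move=> u; rewrite /word_inv map_rev revK -map_comp -[RHS]map_id.
by apply: eq_map => -[i e] /=; rewrite negbK.
Qed.

Lemma word_inv_eq u v : braid_eq u v -> braid_eq (word_inv u) (word_inv v).
Proof.
elim=> [w|? ? _|? w ? _ + _|u' v' i e|u' v'].
- exact: braid_eq_refl.
- exact: braid_eq_sym.
- exact: braid_eq_trans.
- rewrite !word_inv_cat -catA.
  by have := braid_eq_cancel (word_inv v') (word_inv u') i e; rewrite /= negbK.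
- rewrite !word_inv_cat -!catA.
  have Einv (a b c : bool * bool) : word_inv [:: a; b; c] =
    [:: (c.1, ~~ c.2); (b.1, ~~ b.2); (a.1, ~~ a.2)] by [].
  apply: braid_eq_ctx; rewrite !Einv /=.
  pose s1 := (false, false); pose s2 := (true, false).
  pose r1 := (false, true); pose r2 := (true, true).
  have c1 a b : braid_eq (a ++ [:: s1; r1] ++ b) (a ++ b).
    exact: braid_eq_cancel.
  have c2 a b : braid_eq (a ++ [:: s2; r2] ++ b) (a ++ b).
    exact: braid_eq_cancel.
  have d1 a b : braid_eq (a ++ [:: r1; s1] ++ b) (a ++ b).
    exact: braid_eq_cancel.
  have d2 a b : braid_eq (a ++ [:: r2; s2] ++ b) (a ++ b).
    exact: braid_eq_cancel.
  apply: (@braid_eq_trans _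
     ([:: r1; r2; r1] ++ [:: s2; s1; s2] ++ [:: r2; r1; r2])).
    apply: braid_eq_sym.
    apply: braid_eq_trans (c2 [:: r1; r2; r1; s2; s1] [:: r1; r2]) _.
    apply: braid_eq_trans (c1 [:: r1; r2; r1; s2] [:: r2]) _.
    exact: (c2 [:: r1; r2; r1] [::]).
  apply: (@braid_eq_trans _
     ([:: r1; r2; r1] ++ [:: s1; s2; s1] ++ [:: r2; r1; r2])).
    exact/braid_eq_sym/(braid_eq_braid [:: r1; r2; r1] [:: r2; r1; r2]).
  apply: braid_eq_trans (d1 [:: r1; r2] [:: s2; s1; r2; r1; r2]) _.
  apply: braid_eq_trans (d2 [:: r1] [:: s1; r2; r1; r2]) _.
  exact: (d1 [::] [:: r2; r1; r2]).
Qed.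

Definition braid_one : Br3 := braid_of [::].
Definition braid_mul (x y : Br3) : Br3 := braid_of (repr x ++ repr y).
Definition braid_inv (x : Br3) : Br3 := braid_of (word_inv (repr x)).

Lemma braid_mulE u v :
  braid_mul (braid_of u) (braid_of v) = braid_of (u ++ v).
Proof. by apply/braid_ofP; apply: braid_eq_cat; exact: repr_braid_of. Qed.

Lemma braid_invE u : braid_inv (braid_of u) = braid_of (word_inv u).
Proof. by apply/braid_ofP; apply: word_inv_eq; exact: repr_braid_of. Qed.

Lemma braid_ind (P : Br3 -> Prop) : (forall u, P (braid_of u)) -> forall x, P x.
Proof. by move=> Pu x; rewrite -[x]reprK; exact: Pu. Qed.

Lemma braid_mulA : associative braid_mul.
Proof.
elim/braid_ind=> u; elim/braid_ind=> v; elim/braid_ind=> w.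
by rewrite !braid_mulE catA.
Qed.

Lemma braid_mul1g : left_id braid_one braid_mul.
Proof. by elim/braid_ind=> u; rewrite braid_mulE. Qed.

Lemma braid_mulg1 : right_id braid_one braid_mul.
Proof. by elim/braid_ind=> u; rewrite braid_mulE cats0. Qed.

Lemma braid_mulgV : right_inverse braid_one braid_inv braid_mul.
Proof.
elim/braid_ind=> u; rewrite braid_invE braid_mulE; apply/braid_ofP.
elim/last_ind: u => [|u [i e] IH]; first exact: braid_eq_refl.
rewrite -cats1 word_inv_cat -catA.
exact: braid_eq_trans (braid_eq_cancel _ _ i e) IH.
Qed.

Lemma braid_mulVg : left_inverse braid_one braid_inv braid_mul.
Proof.
elim/braid_ind=> u.
have := braid_mulgV (braid_of (word_inv u)).
by rewrite !braid_invE word_invK.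
Qed.

HB.instance Definition _ := isGroup.Build Br3
  braid_mulA braid_mul1g braid_mulg1 braid_mulVg braid_mulgV.

Definition sigma1 : Br3 := braid_of [:: (false, false)].
Definition sigma2 : Br3 := braid_of [:: (true, false)].

Definition semigroup_gen (G : groupType) (S : set G) : set G :=
  [set x | exists s : seq G,
     [/\ s != [::], forall y, y \in s -> S y & x = (\prod_(y <- s) y)%g]].

Definition positive_braids : set Br3 := semigroup_gen [set sigma1; sigma2].

(* The field [Q(t)], which contains [Z[t, t^-1]]. *)
Local Notation Qt := {fraction {poly int}}.

Definition tX : Qt := tofrac 'X.

Definition mx22 (R : Type) (a b c d : R) : 'M[R]_2 :=
  \matrix_(i, j) if i == 0 then (if j == 0 then a else b)
                 else (if j == 0 then c else d).

Definition burau_gen (i : bool) : 'M[Qt]_2 :=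
  if i then mx22 1 0 tX (- tX) else mx22 (- tX) 1 0 1.

Definition burau_letter (l : bool * bool) : 'M[Qt]_2 :=
  if l.2 then (burau_gen l.1)^-1 else burau_gen l.1.

Definition burau_word (u : braid_word) : 'M[Qt]_2 :=
  \prod_(l <- u) burau_letter l.

Definition burau (g : Br3) : 'M[Qt]_2 := burau_word (repr g).

Lemma mx22M (R : nzRingType) (a b c d a' b' c' d' : R) :
  mx22 a b c d * mx22 a' b' c' d' =
  mx22 (a * a' + b * c') (a * b' + b * d') (c * a' + d * c') (c * b' + d * d').
Proof.
apply/matrixP => i j; rewrite !mxE !big_ord_recl big_ord0 !mxE /= addr0.
by case: (i == 0); case: (j == 0).
Qed.

Lemma mx22_1 (R : nzRingType) : mx22 1 0 0 1 = 1 :> 'M[R]_2.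
Proof.
apply/matrixP => i j; rewrite !mxE.
by case: i => -[|[|//]] ?; case: j => -[|[|//]] ?.
Qed.

Lemma tX_neq0 : tX != 0.
Proof. by rewrite tofrac_eq0 polyX_eq0. Qed.

Lemma burau_gen_unit i : burau_gen i \is a GRing.unit.
Proof.
apply/unitrP; exists (if i then mx22 1 0 1 (- tX^-1) else mx22 (- tX^-1) tX^-1 0 1).
by case: i; rewrite /burau_gen !mx22M -mx22_1;
  rewrite !(mul0r, mulr0, mul1r, mulr1, add0r, addr0, mulrN, mulNr, opprK,
    mulVf, mulfV, tX_neq0, addNr, addrN).
Qed.

Lemma burau_word_cat u v : burau_word (u ++ v) = burau_word u * burau_word v.
Proof. by rewrite /burau_word big_cat. Qed.

Lemma burau_word_eq u v : braid_eq u v -> burau_word u = burau_word v.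
Proof.
elim=> // [? ? ? _ -> _ ->//|a b i e|a b]; rewrite !burau_word_cat.
  congr (_ * _); rewrite -[RHS]mul1r; congr (_ * _).
  rewrite /burau_word !big_cons big_nil mulr1 /burau_letter.
  by case: e => /=; rewrite ?mulVr ?mulrV// burau_gen_unit.
congr (_ * (_ * _)); rewrite /burau_word !big_cons !big_nil !mulr1.
rewrite /burau_letter /burau_gen /= !mx22M.
rewrite !(mul0r, mulr0, mul1r, mulr1, add0r, addr0, mulrN, mulNr, opprK).
by rewrite !(addNr, addrN, mulr0, add0r, addr0).
Qed.

Lemma burau_braid_of u : burau (braid_of u) = burau_word u.
Proof. exact/burau_word_eq/repr_braid_of. Qed.

Lemma burau1 : burau 1%g = 1.
Proof. by rewrite burau_braid_of /burau_word big_nil. Qed.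

Lemma burauM x y : burau (x * y)%g = burau x * burau y.
Proof.
elim/braid_ind: x => u; elim/braid_ind: y => v.
by rewrite [(_ * _)%g]braid_mulE !burau_braid_of burau_word_cat.
Qed.

Lemma burau_sigma1 : burau sigma1 = mx22 (- tX) 1 0 1.
Proof. by rewrite burau_braid_of /burau_word big_seq1. Qed.

Lemma burau_sigma2 : burau sigma2 = mx22 1 0 tX (- tX).
Proof. by rewrite burau_braid_of /burau_word big_seq1. Qed.

(* On positive braids the Burau matrix has entries in [Z[t]], so it can be
   evaluated at every [t], including [t = 0]. *)
Definition burau_poly (g : Br3) : 'M[{poly int}]_2 :=
  xget 0 [set M | map_mx (@tofrac _) M = burau g].

Lemma burau_polyP g : positive_braids g -> map_mx (@tofrac _) (burau_poly g) = burau g.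
Proof.
move=> [s [_ sS ->]]; rewrite /burau_poly.
suff [M hM] : exists M : 'M[{poly int}]_2,
    map_mx (@tofrac _) M = burau (\prod_(y <- s) y)%g.
  by case: xgetP => [//|/(_ M)]; exact.
elim: s sS => [|x s IH] sS; first by exists 1; rewrite big_nil burau1 map_mx1.
have [y ys|M hM] := IH; first by apply: sS; rewrite inE ys orbT.
suff [N hN] : exists N : 'M[{poly int}]_2, map_mx (@tofrac _) N = burau x.
  by exists (N * M); rewrite big_cons burauM -hM -hN; exact: map_mxM.
have [->|->] := sS x (mem_head _ _).
  exists (mx22 (- 'X) 1 0 1); rewrite burau_sigma1.
  apply/matrixP => i j; rewrite !mxE.
  by case: (i == 0); case: (j == 0); rewrite ?rmorphN ?rmorph1 ?rmorph0.
exists (mx22 1 0 'X (- 'X)); rewrite burau_sigma2.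
apply/matrixP => i j; rewrite !mxE.
by case: (i == 0); case: (j == 0); rewrite ?rmorphN ?rmorph1 ?rmorph0.
Qed.

Definition int_poly_C (R : realType) (p : {poly int}) : {poly R[i]} :=
  map_poly intr p.

Definition burau_at (R : realType) (t : R[i]) (g : Br3) : 'M[R[i]]_2 :=
  map_mx (fun p => (int_poly_C R p).[t]) (burau_poly g).

(* Among the representatives modulo the units [+-t^k], we choose one that is a
   polynomial and does not vanish at [0] unless it is zero, so that [0] is a root
   only if the Alexander polynomial is zero. *)
Definition is_alexander (w : Br3) (p : {poly int}) : Prop :=
  (p != 0 -> p.[0] != 0) /\
  exists k : int,
    \det (burau w - 1) / tofrac ('X^2 + 'X + 1) = tofrac p * tX ^ k.

Definition alexander (w : Br3) : {poly int} := xget 0 [set p | is_alexander w p].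

Lemma det_mx22 (R : comNzRingType) (a b c d : R) :
  \det (mx22 a b c d) = a * d - b * c.
Proof.
rewrite (expand_det_row _ ord0) !big_ord_recl big_ord0 /cofactor !det_mx11.
by rewrite !mxE /= expr0 expr1 mul1r mulN1r mulrN addr0.
Qed.

Lemma mx22B (R : nzRingType) (a b c d a' b' c' d' : R) :
  mx22 a b c d - mx22 a' b' c' d' = mx22 (a - a') (b - b') (c - c') (d - d').
Proof.
by apply/matrixP => i j; rewrite !mxE; case: (i == 0); case: (j == 0).
Qed.

(* [Z[t, t^-1]] as a subset of [Q(t)]. *)
Definition laurent (x : Qt) : Prop :=
  exists (n : nat) (p : {poly int}), x * tX ^+ n = tofrac p.

Lemma tofrac_laurent p : laurent (tofrac p).
Proof. by exists 0%N, p; rewrite mulr1. Qed.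

Lemma laurentM x y : laurent x -> laurent y -> laurent (x * y).
Proof.
move=> [n [p xp]] [m [q yq]]; exists (n + m)%N, (p * q).
by rewrite exprD mulrACA xp yq rmorphM.
Qed.

Lemma laurentD x y : laurent x -> laurent y -> laurent (x + y).
Proof.
move=> [n [p xp]] [m [q yq]]; exists (n + m)%N, (p * 'X^m + q * 'X^n).
rewrite rmorphD !rmorphM /= !rmorphXn /= -xp -yq -/tX mulrDl exprD mulrA.
by congr (_ + _); rewrite -!mulrA [tX ^+ m * _]mulrC.
Qed.

Lemma laurentN x : laurent x -> laurent (- x).
Proof. by move=> [n [p xp]]; exists n, (- p); rewrite mulNr xp rmorphN. Qed.

Lemma laurent1 : laurent 1.
Proof. by rewrite -(rmorph1 (@tofrac _)); exact: tofrac_laurent. Qed.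

Lemma laurent0 : laurent 0.
Proof. by rewrite -(rmorph0 (@tofrac _)); exact: tofrac_laurent. Qed.

Lemma laurentV : laurent tX^-1.
Proof. by exists 1%N, 1; rewrite expr1 mulVf ?tX_neq0 ?rmorph1. Qed.

Lemma burau_letterE l : burau_letter l =
  if l.2 then if l.1 then mx22 1 0 1 (- tX^-1) else mx22 (- tX^-1) tX^-1 0 1
  else if l.1 then mx22 1 0 tX (- tX) else mx22 (- tX) 1 0 1.
Proof.
case: l => i [] //; rewrite /burau_letter /=; apply: (mulrI (burau_gen_unit i)).
rewrite divrr ?burau_gen_unit// /burau_gen.
by case: i; rewrite !mx22M -mx22_1;
  rewrite !(mul0r, mulr0, mul1r, mulr1, add0r, addr0, mulrN, mulNr, opprK,
    mulVf, mulfV, tX_neq0, addNr, addrN).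
Qed.

Lemma burau_fix_aux (F : fieldType) (t a b c d r s : F) : t != 0 ->
    a = 1 + (t ^+ 2 + t + 1) * r - b * (1 + t) ->
    c = 1 + t + (t ^+ 2 + t + 1) * s - d * (1 + t) ->
  [/\ - t^-1 * a + t^-1 * c + (- t^-1 * b + t^-1 * d) * (1 + t) =
        1 + (t ^+ 2 + t + 1) * (t^-1 * s - t^-1 * r),
      - t * a + 1 * c + (- t * b + 1 * d) * (1 + t) =
        1 + (t ^+ 2 + t + 1) * (s - t * r),
      1 * a + - t^-1 * c + (1 * b + - t^-1 * d) * (1 + t) =
        1 + t + (t ^+ 2 + t + 1) * (r - t^-1 * s - t^-1) &
      t * a + - t * c + (t * b + - t * d) * (1 + t) =
        1 + t + (t ^+ 2 + t + 1) * (t * r - t * s - 1)].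
Proof. by move=> t0 -> ->; split; do ?[by ring | by field]. Qed.

Lemma burau_det_aux (F : fieldType) (t b d r s : F) :
  (1 + (t ^+ 2 + t + 1) * r - b * (1 + t) - 1) * (d - 1) -
  b * (1 + t + (t ^+ 2 + t + 1) * s - d * (1 + t)) =
  (r * (d - 1) - s * b) * (t ^+ 2 + t + 1).
Proof. by ring. Qed.

Local Notation Phi := (tX ^+ 2 + tX + 1).

(* [burau g] fixes the column vector [(1, 1 + t)] modulo [t^2 + t + 1]. *)
Lemma burau_fix u : exists a b c d r s : Qt,
  [/\ burau_word u = mx22 a b c d, laurent b /\ laurent d,
      laurent r /\ laurent s,
      a + b * (1 + tX) = 1 + Phi * r &
      c + d * (1 + tX) = 1 + tX + Phi * s].
Proof.
have lX : laurent tX by exact: tofrac_laurent.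
have lV := laurentV; have l0 := laurent0; have l1 := laurent1.
have Xn0 := tX_neq0.
elim: u => [|l u [a [b [c [d [r [s [E [lb ld] [lr ls] e1 e2]]]]]]]].
  exists 1, 0, 0, 1, 0, 0; split; rewrite ?mul0r ?mul1r ?mulr0 ?addr0 ?add0r//.
  by rewrite /burau_word big_nil -mx22_1.
have ea : a = 1 + Phi * r - b * (1 + tX) by rewrite -e1 addrK.
have ec : c = 1 + tX + Phi * s - d * (1 + tX) by rewrite -e2 addrK.
have [f1 f2 f3 f4] := burau_fix_aux Xn0 ea ec.
rewrite /burau_word big_cons -/(burau_word u) E burau_letterE.
case: l => [[] []] /=; rewrite mx22M.
- exists (1 * a + 0 * c), (1 * b + 0 * d), (1 * a + - tX^-1 * c),
    (1 * b + - tX^-1 * d), r, (r - tX^-1 * s - tX^-1); split=> //.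
  + by split; do ?[exact: l0|exact: l1|exact: laurentV|assumption|
       apply: laurentD|apply: laurentM|apply: laurentN].
  + by split=> //; do ?[exact: laurentV|assumption|
       apply: laurentD|apply: laurentM|apply: laurentN].
  + by rewrite !mul1r !mul0r !addr0.
- exists (1 * a + 0 * c), (1 * b + 0 * d), (tX * a + - tX * c),
    (tX * b + - tX * d), r, (tX * r - tX * s - 1); split=> //.
  + by split; do ?[assumption|apply: laurentD|apply: laurentM|apply: laurentN].
  + by split=> //; do ?[assumption|apply: laurentD|apply: laurentM|apply: laurentN].
  + by rewrite !mul1r !mul0r !addr0.
- exists (- tX^-1 * a + tX^-1 * c), (- tX^-1 * b + tX^-1 * d), (0 * a + 1 * c),
    (0 * b + 1 * d), (tX^-1 * s - tX^-1 * r), s; split=> //.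
  + by split; do ?[assumption|apply: laurentD|apply: laurentM|apply: laurentN].
  + by split=> //; do ?[assumption|apply: laurentD|apply: laurentM|apply: laurentN].
  + by rewrite !mul1r !mul0r !add0r.
- exists (- tX * a + 1 * c), (- tX * b + 1 * d), (0 * a + 1 * c),
    (0 * b + 1 * d), (s - tX * r), s; split=> //.
  + by split; do ?[assumption|apply: laurentD|apply: laurentM|apply: laurentN].
  + by split=> //; do ?[assumption|apply: laurentD|apply: laurentM|apply: laurentN].
  + by rewrite !mul1r !mul0r !add0r.
Qed.

Lemma expfz_aux (F : fieldType) (x y t : F) (m n : nat) : t != 0 ->
  x * t ^+ n = y * t ^+ m -> x = y * t ^ (m%:Z - n%:Z).
Proof.
move=> t0 /(canRL (mulfK (expf_neq0 n t0))) ->.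
by rewrite expfzDr// mulrA exprnN.
Qed.

Lemma alexanderP w : is_alexander w (alexander w).
Proof.
rewrite /alexander; suff [p hp] : exists p, is_alexander w p.
  by case: xgetP => [//|/(_ p)]; exact.
elim/braid_ind: w => u.
have [a [b [c [d [r [s [E [lb ld] [lr ls] e1 e2]]]]]]] := burau_fix u.
have ea : a = 1 + Phi * r - b * (1 + tX) by rewrite -e1 addrK.
have ec : c = 1 + tX + Phi * s - d * (1 + tX) by rewrite -e2 addrK.
have PhiE : tofrac ('X^2 + 'X + 1) = Phi by rewrite !rmorphD rmorphXn rmorph1.
have Phi0 : Phi != 0.
  rewrite -PhiE tofrac_eq0; apply/negP => /eqP/(congr1 (fun p => p.[0])).
  rewrite !hornerE /=; exact/eqP.
have detE : \det (burau (braid_of u) - 1) / Phi = r * (d - 1) - s * b.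
  rewrite burau_braid_of E -mx22_1 mx22B det_mx22 subr0 [c - 0]subr0.
  by apply/(canLR (mulfK Phi0)); rewrite ?subr0 ea ec -burau_det_aux.
have [n [p]] : laurent (\det (burau (braid_of u) - 1) / Phi).
  rewrite detE; have l1 := laurent1.
  by do ?[assumption|apply: laurentD|apply: laurentM|apply: laurentN].
have [m [q q0 pq]] := multiplicity_XsubC p 0.
move: q0 pq; rewrite subr0 => + pq; rewrite pq => q0 pE.
exists q; split.
  by move=> qn0; move: q0; rewrite mulf_neq0 ?expf_neq0 ?polyX_eq0.
exists (m%:Z - n%:Z); rewrite PhiE; apply: expfz_aux tX_neq0 _.
by rewrite pE tofracM tofracXn.
Qed.

(* The zero polynomial vanishes to infinite order at every point. *)
Definition root_mult (R : realType) (p : {poly int}) (t : R[i]) : \bar R :=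
  if p == 0 then +oo%E else ((mup t (int_poly_C R p))%:R)%:E.

Definition root_count (R : realType) (p : {poly int}) (K : set R[i]) : \bar R :=
  (\esum_(t in K) root_mult p t)%E.

HB.instance Definition _ := isPointed.Build Br3 1%g.
HB.instance Definition _ := @isMeasurable.Build default_measure_display
  Br3 discrete_measurable discrete_measurable0
  discrete_measurableC discrete_measurableU.

Lemma measurable_braid_mul :
  measurable_fun setT (fun p : Br3 * Br3 => (p.1 * p.2)%g).
Proof.
move=> _ A _; rewrite setTI.
apply: countable_measurable => [[x y]|]; last exact: countableP.
rewrite (_ : [set (x, y)] = [set x] `*` [set y]); first exact: measurableX.
by apply/seteqP; split=> [[a b] [-> ->]|[a b] [/= -> ->]].
Qed.

Section convolution.
Context (R : realType).
Implicit Types m : probability Br3 R.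

Definition convolution m1 m2 : set Br3 -> \bar R :=
  pushforward (m1 \x m2)%E (fun p : Br3 * Br3 => (p.1 * p.2)%g).

Variables m1 m2 : probability Br3 R.

Let mul_mfun : {mfun (Br3 * Br3)%type >-> Br3} :=
  mfun_Sub (mem_set measurable_braid_mul).

HB.instance Definition _ := Probability.copy (convolution m1 m2)
  (distribution (m1 \x m2)%E mul_mfun).
End convolution.

Fixpoint conv_pow (R : realType) (m : probability Br3 R) (n : nat) :
    probability Br3 R :=
  if n is n'.+1 then convolution (conv_pow m n') m else dirac (1%g : Br3).

(* [Br3] is countable with the discrete sigma-algebra, so measures on it are
   determined by their atoms. *)
Definition supp (R : realType) (m : probability Br3 R) : set Br3 :=
  [set g | m [set g] != 0%E].

Definition generating (R : realType) (m : probability Br3 R) : Prop :=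
  semigroup_gen (supp m) = positive_braids.

Definition mutually_independent (R : realType) (d : measure_display)
    (Omega : measurableType d) (P : probability Omega R)
    (g : nat -> {RV P >-> Br3}) : Prop :=
  forall (J : {fset nat}) (A : nat -> set Br3),
    P (\bigcap_(i in [set` J]) (g i @^-1` A i)) =
    (\prod_(i <- J) P (g i @^-1` A i))%E.

Definition random_walk (R : realType) (d : measure_display)
    (Omega : measurableType d) (P : probability Omega R)
    (g : nat -> {RV P >-> Br3}) (n : nat) (omega : Omega) : Br3 :=
  (\prod_(i < n) g i omega)%g.

Import Normc.

Section lyapunov.
Context (R : realType) (mu : probability Br3 R).
Local Open Scope ereal_scope.

(* [lne 0 = -oo], so the integral is [-oo] when [B_t(g) = 0] with positive
   probability, e.g. at [t = 0]. The matrix norm is the maximum of the moduli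
   of the entries. *)
Definition lyapunov (t : R[i]) : \bar R :=
  limn (fun n => (n%:R^-1)%:E *
    \int[conv_pow mu n]_g lne `|map_mx (@normc R) (burau_at t g)|%:E).

Definition log_plus (x : R) : R := Num.max 0%R (ln x).

Definition chi (t : R[i]) : \bar R :=
  Order.max (lyapunov t) (log_plus (normc t))%:E.

(* [C] is identified with [R^2], which carries the topology and the Lebesgue
   measure. *)
Definition cplx (z : R * R) : R[i] := Complex z.1 z.2.

Definition partial1 (f : R * R -> R) (z : R * R) : R := 'D_(1%R, 0%R) f z.
Definition partial2 (f : R * R -> R) (z : R * R) : R := 'D_(0%R, 1%R) f z.

Fixpoint Ck (k : nat) (f : R * R -> R) : Prop :=
  if k is k'.+1 then
    [/\ continuous f,
        forall z, derivable f z (1%R, 0%R) /\ derivable f z (0%R, 1%R),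
        Ck k' (partial1 f) & Ck k' (partial2 f)]
  else continuous f.

Definition test_function (phi : R * R -> R) : Prop :=
  (forall k, Ck k phi) /\ compact (closure [set z | phi z != 0%R]).

Definition laplacian (f : R * R -> R) (z : R * R) : R :=
  (partial1 (partial1 f) z + partial2 (partial2 f) z)%R.

Definition lebesgue2 := (@lebesgue_measure R \x @lebesgue_measure R).

(* [nu = (2 pi)^-1 dd^c chi] as distributions on [C = R^2]. *)
Definition is_bifurcation_measure (nu : {measure set (R * R) -> \bar R}) : Prop :=
  (forall A : set (R * R), compact A -> nu A < +oo) /\
  forall phi, test_function phi ->
    \int[nu]_z (phi z)%:E =
    ((2 * pi)^-1)%:E * \int[lebesgue2]_z (chi (cplx z) * (laplacian phi z)%:E).

End lyapunov.

(* Main.v *)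
From HB Require Import structures.
Require Import Defs.
From mathcomp Require Import all_boot all_order all_algebra.
From mathcomp Require Import all_classical all_reals all_analysis.
From mathcomp Require Import measurable_realfun.
From mathcomp Require Import finmap ring lra.
From mathcomp Require Import complex.

(** Let [lambda(t0) < 0]. Then some convolution power [mu^{*m}] has mean log-norm of
    [B_{t0}] as negative as one wishes, and since a mean logarithm is the
    derivative at [s = 0] of the moments of order [s], a small power of the norm
    has [mu^{*m}]-mean below one ([exp_moment_lt1]). The measure is finitely
    supported and Burau matrices depend continuously on [t], so the same bound
    holds for the supremum of the norm over a small ball [U] around [t0].
    Submultiplicativity makes the means [a_n], under [mu^{*n}], of the [s]-th power
    of [sup_U ||B_t||] summable in [n] ([moments_summable_near]). Everything
    follows from this.

    Roots. The walk at time [n] has law [mu^{*n}] ([random_walk_law]), so by Markov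
    and Borel-Cantelli, almost surely, [sup_U ||B_t(w_n)||] is eventually small
    ([ae_eventually_contracting]). Then [det (B_t(w_n) - 1)] does not vanish on [U],
    and the Alexander polynomial has no root in [U] at all ([root_count_eq0]). A
    finite cover of [K] by such balls shows that the number of roots in [K] is
    almost surely zero for all large [n].

    Bifurcation measure. As [log x] is at most a multiple of [x^s], the boundedness
    of [a_n] gives [lambda <= 0] on [U]; as [log^+|t| = 0] on the unit disc, [chi]
    vanishes on [U] ([chi_eq0]). The measure is then zero on [U], tested against
    smooth bumps ([bifurcation_measure_ball0]). The bumps are built from
    [exp (-1/x)]: the family of functions [p(1/x) exp (-1/x)] is stable under
    derivation ([is_derive_flat]). Again a finite cover concludes. *)

Set Implicit Arguments.
Unset Strict Implicit.
Unset Printing Implicit Defensive.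

Import Order.TTheory GRing.Theory Num.Theory.
Import numFieldNormedType.Exports.

Local Open Scope classical_set_scope.
Local Open Scope ring_scope.

(** * Burau matrices at a point, and roots of the Alexander polynomial *)

Section burau_norm.
Variable R : realType.
Implicit Types (t : R[i]) (g h : Br3).

(** A submonoid that contains the positive braids and, unlike them, the identity;
    on it the evaluation of the Burau matrix is multiplicative at every [t],
    including [t = 0]. *)
Definition poly_burau : set Br3 :=
  [set g | exists M : 'M[{poly int}]_2, map_mx (@tofrac _) M = burau g].

Lemma burau_poly_tofrac g : poly_burau g ->
  map_mx (@tofrac _) (burau_poly g) = burau g.
Proof. by move=> [M hM]; rewrite /burau_poly; case: xgetP => [//|/(_ M)]; exact. Qed.

Lemma map_tofrac_inj (M N : 'M[{poly int}]_2) :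
  map_mx (@tofrac _) M = map_mx (@tofrac _) N -> M = N.
Proof.
move=> /matrixP e; apply/matrixP => i j; have := e i j; rewrite !mxE.
by move/eqP; rewrite tofrac_eq => /eqP.
Qed.

Lemma positive_poly_burau : positive_braids `<=` poly_burau.
Proof. by move=> g /burau_polyP e; exists (burau_poly g). Qed.

Lemma poly_burau1 : poly_burau 1%g.
Proof. by exists 1; rewrite burau1 map_mx1. Qed.

Lemma poly_burauM g h : poly_burau g -> poly_burau h -> poly_burau (g * h)%g.
Proof.
move=> [M hM] [N hN]; exists (M * N).
by rewrite burauM -hM -hN; exact: map_mxM.
Qed.

Lemma burau_polyM g h : poly_burau g -> poly_burau h ->
  burau_poly (g * h)%g = burau_poly g * burau_poly h.
Proof.
move=> Pg Ph; apply: map_tofrac_inj.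
rewrite burau_poly_tofrac; last exact: poly_burauM.
by rewrite burauM -!burau_poly_tofrac//; exact/esym/map_mxM.
Qed.

Definition int_eval t (p : {poly int}) : R[i] := (int_poly_C R p).[t].

Lemma int_evalD t : {morph int_eval t : p q / p + q}.
Proof. by move=> p q; rewrite /int_eval /int_poly_C rmorphD hornerD. Qed.

Lemma int_evalM t : {morph int_eval t : p q / p * q}.
Proof. by move=> p q; rewrite /int_eval /int_poly_C rmorphM hornerM. Qed.

Lemma int_evalN t : {morph int_eval t : p / - p}.
Proof. by move=> p; rewrite /int_eval /int_poly_C rmorphN hornerN. Qed.

Lemma int_eval0 t : int_eval t 0 = 0.
Proof. by rewrite /int_eval /int_poly_C rmorph0 horner0. Qed.

Lemma int_eval1 t : int_eval t 1 = 1.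
Proof. by rewrite /int_eval /int_poly_C rmorph1 hornerC. Qed.

Lemma int_evalX t : int_eval t 'X = t.
Proof. by rewrite /int_eval /int_poly_C map_polyX hornerX. Qed.

Lemma int_evalXn t n : int_eval t 'X^n = t ^+ n.
Proof. by rewrite /int_eval /int_poly_C map_polyXn hornerXn. Qed.

Lemma burau_atM t g h : poly_burau g -> poly_burau h ->
  burau_at t (g * h)%g = burau_at t g * burau_at t h.
Proof.
move=> Pg Ph; rewrite /burau_at burau_polyM//; apply/matrixP => i j.
rewrite !mxE -/(int_eval t _) !big_ord_recl !big_ord0 !addr0 int_evalD !int_evalM.
by rewrite !mxE.
Qed.

Definition burau_norm t g : R := `|map_mx (@Normc.normc R) (burau_at t g)|.

Lemma normc_ge0 (z : R[i]) : 0 <= Normc.normc z.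
Proof. by case: z => a b; exact: sqrtr_ge0. Qed.

Let map_normcE t g i j :
  map_mx (@Normc.normc R) (burau_at t g) i j = Normc.normc (burau_at t g i j).
Proof. by rewrite mxE. Qed.

Lemma burau_norm_entry t g i j :
  Normc.normc (burau_at t g i j) <= burau_norm t g.
Proof.
rewrite /burau_norm [leRHS]/Num.Def.normr/= mx_normrE.
apply: le_trans (le_bigmax _ _ (i, j)) => /=.
by rewrite map_normcE ger0_norm ?normc_ge0.
Qed.

Lemma burau_norm_le t g (c : R) : 0 <= c ->
  (forall i j, Normc.normc (burau_at t g i j) <= c) -> burau_norm t g <= c.
Proof.
move=> c0 h; rewrite /burau_norm [leLHS]/Num.Def.normr/= mx_normrE.
apply: bigmax_le => // -[i j] _.
by rewrite /= map_normcE ger0_norm ?normc_ge0.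
Qed.

Lemma burau_norm_ge0 t g : 0 <= burau_norm t g.
Proof. exact: normr_ge0. Qed.

Lemma normcD (x y : R[i]) : Normc.normc (x + y) <= Normc.normc x + Normc.normc y.
Proof. exact: le_normcD. Qed.

(** Twice the maximum norm is submultiplicative on two by two matrices, since an
    entry of a product is a sum of two products. *)
Lemma burau_normM t g h : poly_burau g -> poly_burau h ->
  2 * burau_norm t (g * h)%g <= (2 * burau_norm t g) * (2 * burau_norm t h).
Proof.
move=> Pg Ph; set A := burau_norm t g; set B := burau_norm t h.
suff : burau_norm t (g * h)%g <= 2 * (A * B) by lra.
have AB0 : 0 <= A * B by rewrite mulr_ge0// burau_norm_ge0.
apply: burau_norm_le => [|i j]; first by rewrite mulr_ge0.
rewrite burau_atM// mxE !big_ord_recl big_ord0 addr0.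
apply: le_trans (normcD _ _) _; rewrite !Normc.normcM.
rewrite (_ : 2 * (A * B) = A * B + A * B); last by lra.
by apply: lerD; apply: ler_pM; rewrite ?normc_ge0// burau_norm_entry.
Qed.

Lemma det_mx2E (K : comNzRingType) (A : 'M[K]_2) :
  \det A = A 0 0 * A 1 1 - A 0 1 * A 1 0.
Proof.
suff {1}-> : A = mx22 (A 0 0) (A 0 1) (A 1 0) (A 1 1) by rewrite det_mx22.
apply/matrixP => -[[|[|//]] i2] -[[|[|//]] j2]; rewrite mxE /=;
  congr (A _ _); exact/val_inj.
Qed.

(** If the entries of [B] have modulus at most [1/4], then the product of the
    diagonal entries of [B - 1] has modulus at least [9/16], which the product of
    the other two entries cannot cancel. *)
Lemma det_burau_sub1_neq0 t g : 2 * burau_norm t g < 2^-1 ->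
  \det (burau_at t g - 1) != 0.
Proof.
move=> small; have := burau_norm_entry t g; move: (burau_at t g) => A Asmall.
rewrite det_mx2E !mxE /= !oppr0 !addr0.
set a := A 0 0; set d := A 1 1; set b := A 0 1; set c := A 1 0.
have [a1 b1 c1 d1] : [/\ Normc.normc a <= 4^-1, Normc.normc b <= 4^-1,
    Normc.normc c <= 4^-1 & Normc.normc d <= 4^-1].
  by split; apply: le_trans (Asmall _ _) _; lra.
have far (z : R[i]) : Normc.normc z <= 4^-1 -> 3/4 <= Normc.normc (z - 1).
  move=> z1; have := normcD (z - 1) (- z).
  by rewrite addrAC subrr sub0r !normcN Normc.normc1; lra.
apply/eqP => /eqP; rewrite subr_eq0 => /eqP /(congr1 (@Normc.normc R)).
rewrite !Normc.normcM => e.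
have : 3/4 * (3/4) <= Normc.normc (a - 1) * Normc.normc (d - 1).
  by apply: ler_pM; rewrite ?far//; lra.
have : Normc.normc b * Normc.normc c <= 4^-1 * 4^-1.
  by apply: ler_pM; rewrite ?normc_ge0.
by rewrite e; lra.
Qed.

Lemma expfz_NegzK (F : fieldType) (x t y : F) n : t != 0 ->
  x * t ^ (Negz n) * y * t ^+ n.+1 = x * y.
Proof.
move=> t0; rewrite NegzE -exprnN mulrAC -[x * _ * _]mulrA mulVf ?mulr1//.
by rewrite expf_neq0.
Qed.

(** In [Q(t)] the determinant equals the Alexander polynomial times
    [t^2 + t + 1] times a power [t^k]. A root [t <> 0] of the Alexander polynomial
    is therefore a root of the determinant whatever the sign of [k]. For [k >= 0]
    this also holds at [t = 0]; for [k < 0] the normalisation of the Alexander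
    polynomial at [0] is used instead. *)
Lemma alexander_eval_neq0 w t : poly_burau w ->
  \det (burau_at t w - 1) != 0 -> int_eval t (alexander w) != 0.
Proof.
move=> Pw; set M := burau_poly w.
have -> : \det (burau_at t w - 1) = int_eval t (\det (M - 1)).
  rewrite !det_mx2E !mxE /= !oppr0 !addr0 -!/(int_eval t _).
  by rewrite !(int_evalD, int_evalN, int_evalM) int_eval1.
have [p0 [k]] := alexanderP w; set p := alexander w in p0 *.
rewrite -(burau_poly_tofrac Pw) -/M.
have -> : \det (map_mx (@tofrac _) M - 1) = tofrac (\det (M - 1)).
  have -> : 1 = map_mx (@tofrac _) 1 :> 'M[{fraction {poly int}}]_2.
    by rewrite map_mx1.
  by rewrite -map_mxB det_map_mx.
set q := \det _; set Phi : {poly int} := 'X^2 + 'X + 1.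
have Phi0 : tofrac Phi != 0.
  rewrite tofrac_eq0; apply/negP => /eqP/(congr1 (fun p => p.[0])).
  by rewrite /Phi !hornerE /=; exact/eqP.
move=> /(canRL (divfK Phi0)) e.
have key : (exists n, q = p * 'X^n * Phi) \/ (exists n, q * 'X^n = p * Phi).
  case: k e => n e; [left|right].
    by exists n; apply/eqP; rewrite -tofrac_eq !rmorphM/= rmorphXn/= e.
  exists n.+1; apply/eqP; rewrite -tofrac_eq !rmorphM/= rmorphXn/= e.
  by rewrite -/tX (expfz_NegzK _ _ _ tX_neq0).
case: key => -[n qE].
  by rewrite qE !int_evalM !mulf_eq0 !negb_or => /andP[/andP[]].
have [->|t0] := eqVneq t 0 => qt.
  have pn0 : p != 0.
    apply: contraNneq qt => pE; move: qE.
    rewrite pE mul0r => /eqP; rewrite mulf_eq0 expf_eq0 polyX_eq0 andbF orbF => /eqP ->.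
    by rewrite int_eval0.
  have := p0 pn0; apply: contra.
  rewrite /int_eval /int_poly_C -(rmorph0 (intr : int -> R[i])).
  by rewrite horner_map intr_eq0.
have : int_eval t (q * 'X^n) != 0.
  by rewrite int_evalM int_evalXn mulf_neq0// expf_neq0.
by rewrite qE int_evalM mulf_eq0 negb_or => /andP[].
Qed.

Lemma root_count_eq0 w (K : set R[i]) : poly_burau w ->
  (forall t, K t -> 2 * burau_norm t w < 2^-1) -> root_count (alexander w) K = 0%E.
Proof.
move=> Pw small; apply: esum1 => t /small/det_burau_sub1_neq0/alexander_eval_neq0.
move=> /(_ Pw) pt; rewrite /root_mult ifF; last first.
  by apply: contraNF pt => /eqP ->; rewrite int_eval0.
by rewrite mupNroot//; rewrite rootE.
Qed.

End burau_norm.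

(** * Convolution powers and the law of the random walk *)

Section convolution_powers.
Local Open Scope ereal_scope.
Variable R : realType.
Implicit Types (m mu : probability Br3 R) (F : Br3 -> \bar R).

Lemma braid_measurable (A : set Br3) : measurable A.
Proof. by []. Qed.

Lemma integral_convolution m1 m2 F : (forall x, 0 <= F x) ->
  \int[convolution m1 m2]_z F z = \int[m1]_x \int[m2]_y F (x * y)%g.
Proof.
move=> F0; rewrite ge0_integral_pushforward//; last exact: measurable_braid_mul.
rewrite preimage_setT (fubini_tonelli1 (fun p : Br3 * Br3 => F (p.1 * p.2)%g))//.
by have mF : measurable_fun setT F by []; exact: (measurableT_comp mF measurable_braid_mul).
Qed.

Lemma integral_conv_pow0 mu F : \int[conv_pow mu 0]_z F z = F 1%g.
Proof. by rewrite (integral_dirac _ measurableT)// diracT mul1e. Qed.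

(** The walk at time [a + b] is the product of independent walks at times [a] and
    [b]. [conv_pow] multiplies on the right, whence the induction on [b]. *)
Lemma integral_conv_powD mu a b F : (forall x, 0 <= F x) ->
  \int[conv_pow mu (a + b)]_z F z =
  \int[conv_pow mu a]_x \int[conv_pow mu b]_y F (x * y)%g.
Proof.
elim: b F => [|b IH] F F0.
  rewrite addn0; apply: eq_integral => x _.
  rewrite integral_conv_pow0.
  by congr F; exact/esym/braid_mulg1.
rewrite addnS /= integral_convolution// IH => [|x]; last exact: integral_ge0.
apply: eq_integral => x _; rewrite [RHS]integral_convolution; last by move=> y.
by apply: eq_integral => y _; apply: eq_integral => z _;
  congr F; exact/esym/braid_mulA.
Qed.

Lemma integral_conv_pow1 mu F : (forall x, 0 <= F x) ->
  \int[conv_pow mu 1]_z F z = \int[mu]_x F x.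
Proof.
move=> F0; rewrite [LHS]integral_convolution// (integral_conv_pow0 mu).
apply: eq_integral => x _.
by congr F; exact: braid_mul1g.
Qed.

(** The classes of the counting of [Br3] by [choice.pickle]: each is empty or a
    singleton. Indexing by [nat] makes countable unions over [Br3] available as
    unions of sequences. *)
Definition atom (k : nat) : set Br3 := [set x | choice.pickle x = k].

Definition atom_rep (k : nat) : Br3 := odflt (1%g : Br3) (choice.unpickle k : option Br3).

Lemma atomP k x : atom k x -> x = atom_rep k.
Proof. by move=> <-; rewrite /atom_rep choice.pickleK. Qed.

Lemma bigcup_atom : \bigcup_k atom k = setT.
Proof. by apply/seteqP; split=> // x _; exists (choice.pickle x). Qed.

Lemma supp_full mu : mu (~` supp mu) = 0.
Proof.
apply/(negligibleP mu)/(negligibleS (A := \bigcup_k (~` supp mu `&` atom k))) => //.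
  by rewrite -setI_bigcupr bigcup_atom setIT.
apply: negligible_bigcup => k; apply/negligibleP => //.
have [[x [Nx xk]]|/forallNP h] := pselect (exists x, (~` supp mu `&` atom k) x).
  apply/eqP; rewrite -measure_le0.
  have /negP := Nx; rewrite negbK => /eqP <-.
  apply: le_measure; try exact/mem_set/braid_measurable.
  by move=> y [_ /atomP ->]; rewrite /= -(atomP xk).
by rewrite (_ : _ `&` _ = set0) ?measure0//; apply/seteqP; split.
Qed.

(** The support stays finite along the convolution powers and consists of braids
    with polynomial Burau matrix, being built from products of steps. The
    exceptional set is null, so that later estimates need only hold on [T]. *)
Lemma conv_pow_support mu n : finite_set (supp mu) -> supp mu `<=` poly_burau ->
  exists T : set Br3, [/\ finite_set T, T `<=` poly_burau & conv_pow mu n (~` T) = 0].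
Proof.
move=> fmu Pmu; elim: n => [|n [T [fT PT T0]]].
  exists [set 1%g]; split=> //; first by move=> _ ->; exact: poly_burau1.
  by rewrite /= diracE memNset//= => /(_ erefl).
exists [set (x * y)%g | x in T & y in supp mu]; split.
- exact: finite_image2.
- by move=> _ [x Tx] [y Sy <-]; apply: poly_burauM; [exact: PT|exact: Pmu].
set T' := image2 _ _ _.
have : conv_pow mu n.+1 (~` T') <= \int[conv_pow mu n.+1]_x (\1_(~` T') x)%:E.
  by rewrite integral_indic// setIT.
rewrite /= integral_convolution => [|x]; last by rewrite lee_fin.
move=> le; apply/eqP; rewrite -measure_le0; apply: le_trans le _.
rewrite (ae_eq_integral (cst 0)) ?integral0//.
exists (~` T); split=> // x /=; apply: contra_not => Tx _.
rewrite (ae_eq_integral (cst 0)) ?integral0//.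
exists (~` supp mu); split=> //; first exact: supp_full.
move=> y /=; apply: contra_not => Sy _.
by rewrite indicE memNset//=; apply; exists x => //; exists y.
Qed.

End convolution_powers.

Section walk_law.
Local Open Scope ereal_scope.
Context (R : realType) (mu : probability Br3 R).
Context (d : measure_display) (Omega : measurableType d) (P : probability Omega R).
Variable g : nat -> {RV P >-> Br3}.
Hypothesis g_indep : mutually_independent g.
Hypothesis g_law : forall (i : nat) (A : set Br3), distribution P (g i) A = mu A.

Lemma random_walkS n omega :
  random_walk g n.+1 omega = (random_walk g n omega * g n omega)%g.
Proof. by rewrite /random_walk big_ord_recr. Qed.

Lemma measurable_step i (A : set Br3) : measurable (g i @^-1` A).
Proof. by rewrite -[_ @^-1` _]setTI; exact: measurable_funP. Qed.

Lemma measurable_random_walk n (A : set Br3) : measurable (random_walk g n @^-1` A).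
Proof.
suff : measurable_fun setT (random_walk g n).
  by move=> m; rewrite -[_ @^-1` _]setTI; exact: m.
elim: n => [|n IH].
  rewrite (_ : random_walk g 0 = cst 1%g) //.
  by apply/funext => omega; rewrite /random_walk big_ord0.
rewrite (_ : random_walk g n.+1 =
  (fun p : Br3 * Br3 => (p.1 * p.2)%g) \o (fun omega => (random_walk g n omega, g n omega))).
  apply: measurableT_comp; first exact: measurable_braid_mul.
  by apply/measurable_fun_pair => /=; [exact: IH|exact: measurable_funP].
by apply/funext => omega; rewrite random_walkS.
Qed.

(** The future steps are carried along so that the induction closes: the event at
    time [n + 1] is cut according to the value of the step [n], which on each
    piece becomes one more factor of the future of the walk at time [n]. *)
Lemma random_walk_indep_future n (A : set Br3) (J : {fset nat}) (C : nat -> set Br3) :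
  (forall i, i \in J -> (n <= i)%N) ->
  P ((random_walk g n @^-1` A) `&` \bigcap_(i in [set` J]) (g i @^-1` C i)) =
  conv_pow mu n A * \prod_(i <- J) mu (C i).
Proof.
elim: n A J C => [|n IH] A J C nJ.
  rewrite /= diracE.
  have -> : random_walk g 0 @^-1` A = if (1%g : Br3) \in A then setT else set0.
    rewrite (_ : random_walk g 0 = cst 1%g) ?preimage_cst//.
    by apply/funext => omega; rewrite /random_walk big_ord0.
  case: ifP => _; last by rewrite set0I measure0 mul0e.
  rewrite setTI mul1e g_indep; apply: eq_bigr => i _; exact: g_law.
(* The step [n] joins the future, with values in the class [k]. *)
pose C' k i := if i == n then atom k else C i.
have nNJ : n \notin J by apply/negP => /nJ; rewrite ltnn.
transitivity (\sum_(0 <= k <oo) conv_pow mu n [set x | A (x * atom_rep k)%g] *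
    mu (atom k) * \prod_(i <- J) mu (C i)).
  have -> : (random_walk g n.+1 @^-1` A) `&` \bigcap_(i in [set` J]) (g i @^-1` C i) =
      \bigcup_k (random_walk g n @^-1` [set x | A (x * atom_rep k)%g] `&`
        \bigcap_(i in [set` (n |` J)%fset]) (g i @^-1` C' k i)).
    apply/seteqP; split=> [omega [/= Aw Cw]|omega [k _ [/= Aw Cw]]].
      exists (choice.pickle (g n omega)) => //; split=> /=.
        by rewrite -(@atomP _ (g n omega) erefl) -random_walkS.
      move=> i /=; rewrite in_fset1U /C'; case: eqP => [->//|_] /= iJ.
      exact: Cw.
    have /atomP gn : atom k (g n omega).
      by have := Cw n; rewrite /= in_fset1U /C' eqxx; exact.
    split=> /=; first by rewrite random_walkS gn.
    move=> i iJ; have := Cw i; rewrite /= in_fset1U iJ orbT /C'.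
    by case: eqP => [E|_]; [move: nNJ; rewrite -E iJ|exact].
  rewrite measure_bigcup//; last 2 first.
  - move=> k _; apply: measurableI; first exact: measurable_random_walk.
    by apply: fin_bigcap_measurable => // i _; exact: measurable_step.
  - move=> i j _ _ [omega [[_ wi] [_ wj]]].
    have := wi n; have := wj n; rewrite /= !in_fset1U /C' !eqxx /= /atom /=.
    by move=> /(_ isT) <- /(_ isT) <-.
  rewrite (eq_eseriesl (Q := xpredT)); last by move=> k; rewrite in_setT.
  apply: eq_eseriesr => k _; apply: etrans (IH _ (n |` J)%fset (C' k) _) _.
    by move=> i; rewrite in_fset1U => /predU1P[->//|/nJ/ltnW].
  rewrite big_fsetU1//= /C' eqxx -muleA; congr (_ * (_ * _)).
  by apply: eq_big_seq => i iJ; rewrite ifN//; apply: contraNneq nNJ => <-.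
have /fineK <- : \prod_(i <- J) mu (C i) \is a fin_num.
  by apply: prode_fin_num => i _; exact: fin_num_measure.
rewrite [RHS]muleC; under eq_eseriesr do rewrite muleC.
rewrite nneseriesZl; last by move=> k _; rewrite mule_ge0.
congr (_ * _); rewrite /= /convolution /pushforward.
rewrite (_ : _ @^-1` A = \bigcup_k ([set x | A (x * atom_rep k)%g] `*` atom k)).
  rewrite measure_bigcup//; last 2 first.
  - by move=> k _; exact: measurableX.
  - by move=> i j _ _ [[x y] [[_ /= <-] [_ /= <-]]].
  rewrite [RHS](eq_eseriesl (Q := xpredT)); last by move=> k; rewrite in_setT.
  by apply: eq_eseriesr => k _; apply/esym; exact: product_measure1E.
apply/seteqP; split=> [[x y] /= Axy|[x y] [k _ [/= Axk /atomP ->]]] //.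
by exists (choice.pickle y) => //; split=> //=; rewrite -(@atomP _ y erefl).
Qed.

Lemma random_walk_law n (A : set Br3) : P (random_walk g n @^-1` A) = conv_pow mu n A.
Proof.
have := @random_walk_indep_future n A fset0 (fun=> setT) (fun i => _).
rewrite big_seq_fset0 mule1 => <- //.
by rewrite (_ : [set` _] = set0) ?bigcap_set0 ?setIT//; apply/seteqP; split.
Qed.

End walk_law.

(** * From a negative mean logarithm to a moment below one *)

Section exponential_moment.
Local Open Scope ereal_scope.
Variable R : realType.
Implicit Types (T : set Br3) (nu : probability Br3 R).

Lemma integral_cst_braid nu (r : \bar R) : \int[nu]_g r = r.
Proof.
apply: etrans (integral_cst nu measurableT r) _.
exact: etrans (congr1 (mule r) (probability_setT nu)) (mule1 r).
Qed.

(** From [exp (-x) >= 1 - x > 0], since [(1 - x) (1 + x + 2 x^2) >= 1] for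
    [x <= 1/2]. *)
Lemma expR_le_quadratic (x : R) : (x <= 2^-1 -> expR x <= 1 + x + 2 * x ^+ 2)%R.
Proof.
move=> x2; rewrite -[x in expR x]opprK expRN.
apply: (@le_trans _ _ (1 - x)^-1)%R.
  by rewrite lef_pV2 ?posrE ?expR_gt0 ?expR_ge1Dx//; lra.
rewrite -[leLHS]mul1r ler_pdivrMr; last by lra.
suff : (0 <= x ^+ 2 * (1 - 2 * x))%R by rewrite !expr2; nra.
by rewrite mulr_ge0 ?sqr_ge0//; lra.
Qed.

Lemma finite_set_bounded (I : choiceType) (T : set I) (f : I -> R) : finite_set T ->
  exists M, (1 <= M)%R /\ forall x, T x -> (`|f x| <= M)%R.
Proof.
move=> /finite_fsetP[X ->]; exists (1 + \sum_(x <- X) `|f x|)%R; split.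
  by rewrite lerDl sumr_ge0.
move=> x /= xX; rewrite (big_fsetD1 x)//= addrCA lerDl addr_ge0//.
by rewrite sumr_ge0.
Qed.

Lemma ae_of_full_set T nu (Q : Br3 -> Prop) : nu (~` T) = 0 ->
  (forall g, T g -> Q g) -> {ae nu, forall g, setT g -> Q g}.
Proof.
move=> T0 TQ; exists (~` T); split=> // g /= NQ Tg.
by apply: NQ => _; exact: TQ.
Qed.

Lemma integral_finite_lty T nu (F : Br3 -> \bar R) : finite_set T -> nu (~` T) = 0 ->
  (forall g, 0 <= F g) -> (forall g, T g -> F g < +oo) -> \int[nu]_g F g < +oo.
Proof.
move=> fT T0 F0 FT; have [M [M1 FM]] := finite_set_bounded (fun g => fine (F g)) fT.
apply: (@le_lt_trans _ _ (\int[nu]_g (cst M%:E g))).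
  apply: ae_ge0_le_integral => // [g _|].
    by rewrite lee_fin (le_trans ler01).
  apply: (ae_of_full_set T0) => g Tg; have Fg : F g \is a fin_num by rewrite ge0_fin_numE ?FT.
  by rewrite -(fineK Fg) lee_fin (le_trans (ler_norm _))// FM.
by rewrite (integral_cst_braid nu) ltry.
Qed.

(** The derivative at [s = 0] of the moment of order [s] of [v] is the mean of
    [log v]. As [log v] may take the value [-oo], it is first truncated from
    below; by monotone convergence a truncation at a large level still has mean
    below [-2]. The truncated logarithm is bounded on the finite set [T], and
    [e^y <= 1 + y + 2 y^2] yields a moment below one. The gap between [-2] and
    [- log 2] leaves room for the factor [2] and for the strict inequality
    [v < w], which survives a perturbation of [v]. *)
Lemma exp_moment_lt1 T nu (v : Br3 -> R) : finite_set T -> nu (~` T) = 0 ->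
  (forall g, 0 <= v g)%R -> \int[nu]_g lne (v g)%:E < (-2)%:E ->
  exists s w, [/\ (0 < s)%R, forall g, (v g < w g)%R &
    \int[nu]_g ((2 * w g) `^ s)%:E < 1].
Proof.
move=> fT T0 v0 Lneg.
(* The truncation of [v] from below at [exp (- k)]. *)
pose tr k g := Num.max (v g) (expR (- k%:R)%R).
have tr_gt0 k g : (0 < tr k g)%R by rewrite lt_max expR_gt0 orbT.
have tr0E g : tr 0%N g = Num.max (v g) 1%R by rewrite /tr oppr0 expR0.
(* These nonnegative functions increase to the negative part of [log v]. *)
pose f k g := (ln (tr 0%N g) - ln (tr k g))%:E.
have f_homo g : {homo f^~ g : n m / (n <= m)%N >-> n <= m}.
  move=> n m nm; rewrite lee_fin lerB// ler_ln ?posrE// ge_max !le_max lexx/=.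
  by rewrite ler_expR lerN2 ler_nat nm orbT.
have f0 k g : 0 <= f k g.
  by apply: le_trans (f_homo g 0%N k _) => //; rewrite /f subrr.
have L0 g : 0 <= (ln (tr 0%N g))%:E.
  by rewrite lee_fin ln_ge0// tr0E le_max lexx orbT.
have Lpos g : (fun g => lne (v g)%:E)^\+ g = (ln (tr 0%N g))%:E.
  rewrite funeposE tr0E; have [vg|vg] := lerP (v g) 0.
    rewrite le0_lneNy ?lee_fin// max_r ?leNye//.
    by rewrite max_r ?ln1//; lra.
  rewrite lne_EFin// -EFin_max; congr (_%:E).
  have [v1|v1] := leP (v g) 1%R; first by rewrite max_r ?ln_le0// ln1.
  by rewrite max_l// ln_ge0// ltW.
have Lneg_le g : (fun g => lne (v g)%:E)^\- g <= limn (f^~ g).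
  rewrite (cvg_lim _ (ereal_nondecreasing_cvgn (f_homo g)))//.
  rewrite funenegE; have [vg|vg] := lerP (v g) 0.
    have {}vg : v g = 0%R by apply/eqP; rewrite eq_le vg v0.
    rewrite le0_lneNy ?lee_fin ?vg// leye_eq; apply/eqP/eqyP => A A0.
    have [k Ak] : exists k : nat, (A <= k%:R)%R.
      exists (Num.bound `|A|%R).
      exact: le_trans (ler_norm _) (ltW (archi_boundP (normr_ge0 _))).
    apply: le_trans (_ : f k g <= _); last by apply: ereal_sup_ubound; exists k.
    rewrite lee_fin tr0E /tr vg max_r// ln1 max_r ?expR_ge0// expRK; lra.
  have [k Ak] : exists k : nat, (- ln (v g) <= k%:R)%R.
    exists (Num.bound `|- ln (v g)|%R).
    exact: le_trans (ler_norm _) (ltW (archi_boundP (normr_ge0 _))).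
  apply: le_trans (_ : f k g <= _); last by apply: ereal_sup_ubound; exists k.
  have trk : tr k g = v g.
    by apply/max_l; rewrite -[leRHS]lnK ?posrE// ler_expR; lra.
  rewrite lne_EFin// ge_max f0 andbT lee_fin trk.
  by have := L0 g; rewrite lee_fin; lra.
have fin_int (F : Br3 -> R) : (forall g, 0 <= F g)%R -> \int[nu]_g (F g)%:E \is a fin_num.
  move=> F0; rewrite ge0_fin_numE; last by apply: integral_ge0 => g _; rewrite lee_fin.
  by apply: (integral_finite_lty fT) => // g; rewrite ?lee_fin// ltry.
have := fin_int (fun g => ln (tr 0%N g)) L0; move: Lneg.
rewrite integralE (eq_integral _ _ (fun g _ => Lpos g)).
set Ip := integral _ _ _; set Im := integral _ _ _ => Lneg Ipfin.
have {Lneg} : Ip + 2%:E < Im.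
  move: Lneg; rewrite -(fineK Ipfin); case: Im => [r| |]//=; rewrite ?ltry//.
  by rewrite !lte_fin; lra.
have Imlim : Im <= limn (fun k => \int[nu]_g f k g).
  rewrite -monotone_convergence//.
  by apply: ge0_le_integral => // g _; exact: Lneg_le.
move=> /lt_le_trans /(_ Imlim) Iplt.
have [k klt] : exists k, Ip + 2%:E < \int[nu]_g f k g.
  apply/not_existsP => h; move: Iplt; rewrite ltNge => /negP; apply.
  apply: lime_le; last by apply: nearW => k; rewrite leNgt; apply/negP/h.
  apply: ereal_nondecreasing_is_cvgn => a b ab.
  by apply: ge0_le_integral => // g _; exact: f_homo.
have fkfin : \int[nu]_g f k g \is a fin_num by apply: fin_int => g; exact: f0.
move: klt; rewrite -(fineK Ipfin) -(fineK fkfin) lte_fin.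
set a := fine Ip; set b := fine _ => ab.
pose H g := (ln (tr k g) + 2)%R.
have [M [M1 HM]] := finite_set_bounded H fT.
pose eta := (b - a - 2)%R.
have eta0 : (0 < eta)%R by rewrite /eta; lra.
have M0 : (0 < M)%R by lra.
(* The first bound keeps [s H] below [1/2] on [T]; the second makes the quadratic
   term [2 (s M)^2] at most half of the linear gain [s eta]. *)
pose s := Num.min (2 * M)^-1%R (eta / (4 * M ^+ 2))%R.
have s0 : (0 < s)%R by rewrite lt_min invr_gt0 divr_gt0 ?mulr_gt0// ?exprn_gt0.
pose w g := expR (ln (tr k g) + 1)%R.
exists s, w; split => // [g|].
  apply: (@le_lt_trans _ _ (tr k g)); first by rewrite le_max lexx.
  by rewrite -[ltLHS]lnK ?posrE// ltr_expR; lra.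
have sM : (s * M <= 2^-1)%R.
  have : (s <= (2 * M)^-1)%R by rewrite ge_min lexx.
  by rewrite -(ler_pM2r M0) invfM -mulrA mulVf ?mulr1 ?gt_eqF.
have sM2 : (4 * (s * (M * M)) <= eta)%R.
  have : (s <= eta / (4 * M ^+ 2))%R by rewrite ge_min lexx orbT.
  by rewrite ler_pdivlMr ?mulr_gt0 ?exprn_gt0// expr2; lra.
have pointwise g : T g ->
  (((2 * w g) `^ s) + s * (ln (tr 0%N g) - ln (tr k g)) <=
   (1 + 2 * s + 2 * (s * M) ^+ 2) + s * ln (tr 0%N g))%R.
  move=> Tg; suff : ((2 * w g) `^ s <= 1 + s * H g + 2 * (s * M) ^+ 2)%R.
    by rewrite /H; lra.
  apply: (@le_trans _ _ (expR (s * H g))).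
    rewrite [(s * _)%R]mulrC expRM ge0_ler_powR ?nnegrE ?mulr_ge0 ?expR_ge0//; first exact: ltW.
    rewrite /H (_ : ln (tr k g) + 2 = 1 + (ln (tr k g) + 1))%R; last by lra.
    by rewrite [leRHS]expRD ler_wpM2r ?expR_ge0//; have := expR_ge1Dx (1:R); lra.
  have sH : (`|s * H g| <= s * M)%R.
    by rewrite normrM (gtr0_norm s0); apply: ler_wpM2l; [exact: ltW|exact: HM].
  apply: le_trans (expR_le_quadratic _) _.
    by apply: le_trans (ler_norm _) _; apply: le_trans sH _.
  rewrite lerD2l; apply: ler_wpM2l => //.
  rewrite -[leLHS]real_normK ?num_real// ler_sqr ?nnegrE//.
  exact: le_trans sH.
have : \int[nu]_g (((2 * w g) `^ s)%:E + s%:E * f k g) <=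
    \int[nu]_g ((1 + 2 * s + 2 * (s * M) ^+ 2)%:E + s%:E * (ln (tr 0%N g))%:E).
  apply: ae_ge0_le_integral => // [g _|g _|].
  - by rewrite adde_ge0// ?mule_ge0// lee_fin ?powR_ge0// ltW.
  - by rewrite adde_ge0// ?mule_ge0// lee_fin; nra.
  - by apply: (ae_of_full_set T0) => g /pointwise.
have s0E : 0 <= s%:E by rewrite lee_fin ltW.
rewrite ge0_integralD//; last 2 first.
- by move=> g _; rewrite lee_fin powR_ge0.
- by move=> g _; rewrite mule_ge0.
rewrite ge0_integralD//; last 2 first.
- by move=> g _; rewrite lee_fin; nra.
- by move=> g _; rewrite mule_ge0.
rewrite !ge0_integralZl// (integral_cst_braid nu).
rewrite -/Ip -(fineK Ipfin) -(fineK fkfin) -/a -/b.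
have : 0 <= \int[nu]_g ((2 * w g) `^ s)%:E.
  by apply: integral_ge0 => g _; rewrite lee_fin powR_ge0.
move: (\int[nu]_g ((2 * w g) `^ s)%:E) => [x| |]// _.
rewrite -!EFinM -!EFinD ?lee_fin ?lte_fin => h.
suff : (1 + 2 * s + 2 * (s * M) ^+ 2 + s * a - s * b < 1)%R by lra.
have -> : (1 + 2 * s + 2 * (s * M) ^+ 2 + s * a - s * b =
  1 - s * (eta - 2 * (s * (M * M))))%R by rewrite /eta; ring.
suff : (0 < s * (eta - 2 * (s * (M * M))))%R by lra.
by rewrite mulr_gt0//; lra.
Qed.

End exponential_moment.

(** * Contraction near a point with negative Lyapunov exponent *)

Section continuity.
Variable R : realType.

Lemma near_subset (z0 : R * R) (P Q : R * R -> Prop) : (forall z, P z -> Q z) ->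
  (\forall z \near z0, P z) -> \forall z \near z0, Q z.
Proof. exact: filterS. Qed.

(** Continuity is stated on real and imaginary parts because the parameter ranges
    over [R * R], with its product topology. *)
Lemma int_eval_cplx_continuous (p : {poly int}) :
  continuous (fun z : R * R => complex.Re (int_eval (cplx z) p)) /\
  continuous (fun z : R * R => complex.Im (int_eval (cplx z) p)).
Proof.
elim/poly_ind: p => [|p c [IHr IHi]].
  by split=> z; rewrite [X in continuous_at _ X](_ : _ = cst 0);
    try exact: cvg_cst; apply/funext => w /=; rewrite int_eval0.
have cE (z : R * R) : int_eval (cplx z) (p * 'X + c%:P) =
    Complex (complex.Re (int_eval (cplx z) p) * z.1 -
             complex.Im (int_eval (cplx z) p) * z.2 + c%:~R)
            (complex.Re (int_eval (cplx z) p) * z.2 +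
             complex.Im (int_eval (cplx z) p) * z.1).
  rewrite int_evalD int_evalM int_evalX; case: (int_eval _ p) => a b /=.
  rewrite /int_eval /int_poly_C map_polyC hornerC /= /cplx.
  by rewrite -(rmorph_int (real_complex R)) /=; apply/eqP; rewrite eq_complex /= !addr0 !eqxx.
have c1 : continuous (fun z : R * R => z.1) by move=> z; exact: cvg_fst.
have c2 : continuous (fun z : R * R => z.2) by move=> z; exact: cvg_snd.
split.
  rewrite (_ : (fun z : R * R => _) = (fun z : R * R =>
      complex.Re (int_eval (cplx z) p) * z.1 -
      complex.Im (int_eval (cplx z) p) * z.2 + c%:~R)); last first.
    by apply/funext => z; rewrite cE.
  move=> z; apply: cvgD; last exact: cvg_cst.
  by apply: cvgB; apply: cvgM; [exact: IHr|exact: c1|exact: IHi|exact: c2].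
rewrite (_ : (fun z : R * R => _) = (fun z : R * R =>
    complex.Re (int_eval (cplx z) p) * z.2 +
    complex.Im (int_eval (cplx z) p) * z.1)); last first.
  by apply/funext => z; rewrite cE.
by move=> z; apply: cvgD; apply: cvgM; [exact: IHr|exact: c2|exact: IHi|exact: c1].
Qed.

Lemma near_normc_int_eval_lt (p : {poly int}) (z0 : R * R) (c : R) :
  Normc.normc (int_eval (cplx z0) p) < c ->
  \forall z \near z0, Normc.normc (int_eval (cplx z) p) < c.
Proof.
have [cr ci] := int_eval_cplx_continuous p.
pose S (z : R * R) := complex.Re (int_eval (cplx z) p) * complex.Re (int_eval (cplx z) p) +
  complex.Im (int_eval (cplx z) p) * complex.Im (int_eval (cplx z) p).
have cS : continuous S.
  by move=> z; apply: cvgD; apply: cvgM; [exact: cr|exact: cr|exact: ci|exact: ci].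
have E (z : R * R) : Normc.normc (int_eval (cplx z) p) = Num.sqrt (S z).
  by rewrite /S; case: (int_eval _ p) => x y /=; rewrite !expr2.
rewrite E => h.
have near_h : \forall z \near z0, Num.sqrt (S z) < c.
  have cN : (fun z => Num.sqrt (S z)) @ z0 --> Num.sqrt (S z0).
    by apply: continuous_cvg; [exact: sqrt_continuous|exact: cS].
  exact: (@cvgr_lt _ _ _ (nbhs_filter z0) _ _ cN _ h).
by apply: near_subset near_h => z; rewrite E.
Qed.

Lemma near_burau_norm_lt (g : Br3) (z0 : R * R) (c : R) :
  burau_norm (cplx z0) g < c -> \forall z \near z0, burau_norm (cplx z) g < c.
Proof.
move=> gc.
(* A margin, because the bound on the entries gives only a weak inequality. *)
have [e [e0 ec]] : exists e, burau_norm (cplx z0) g < e /\ e < c.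
  by exists ((burau_norm (cplx z0) g + c) / 2); split; lra.
have near_entry i j : \forall z \near z0, Normc.normc (burau_at (cplx z) g i j) < e.
  have := burau_norm_entry (cplx z0) g i j; rewrite !mxE => le.
  by apply: near_subset (near_normc_int_eval_lt (le_lt_trans le e0)) => z; rewrite mxE.
have near_all : \forall z \near z0, forall i j, Normc.normc (burau_at (cplx z) g i j) < e.
  have FF := nbhs_filter z0.
  apply: (@filter_forall _ _ _ _ FF) => i; apply: (@filter_forall _ _ _ _ FF) => j.
  exact: near_entry.
apply: near_subset near_all => z h; apply: le_lt_trans ec; apply: burau_norm_le => [|i j].
  by apply: ltW; apply: le_lt_trans e0; exact: burau_norm_ge0.
exact/ltW.
Qed.

Lemma near_forall_finite (I : choiceType) (T : set I) (Q : I -> R * R -> Prop) (z0 : R * R) :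
  finite_set T -> (forall g, T g -> \forall z \near z0, Q g z) ->
  \forall z \near z0, forall g, T g -> Q g z.
Proof.
move=> /finite_fsetP[X ->] h.
by apply: near_subset (@filter_bigI _ _ X Q _ (nbhs_filter z0) h).
Qed.

End continuity.

Section submultiplicative.
Variable R : realType.

(** The partial sum up to [N] is at most the one up to [m + N], hence at most the
    sum of the first [m] terms plus [rho] times itself. *)
Lemma partial_sums_bounded (a : nat -> R) m rho : rho < 1 ->
  (forall n, 0 <= a n) -> (forall n, a (m + n)%N <= rho * a n) ->
  exists B, forall N, \sum_(0 <= n < N) a n <= B.
Proof.
move=> rho1 a0 am; exists ((\sum_(0 <= n < m) a n) / (1 - rho)) => N.
rewrite ler_pdivlMr; last by lra.
have : \sum_(0 <= n < N) a n <= \sum_(0 <= n < m + N) a n.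
  rewrite addnC [leRHS](big_cat_nat (n := N)) ?leq_addr//= lerDl.
  by rewrite sumr_ge0.
rewrite (big_cat_nat (n := m) (p := (m + N)%N)) ?leq_addr//=.
suff : \sum_(m <= n < m + N) a n <= rho * \sum_(0 <= n < N) a n by lra.
rewrite -{1}[m]add0n [(m + N)%N]addnC big_addn addnK mulr_sumr.
by apply: ler_sum => i _; rewrite addnC.
Qed.

End submultiplicative.

Section moments.
Local Open Scope ereal_scope.
Variable R : realType.
Implicit Types (mu : probability Br3 R) (U : set R[i]) (s : R) (g h : Br3).

(** The [s]-th power of the norm of the Burau matrix, uniformly over [U]; the factor
    [2] makes it submultiplicative. *)
Definition sup_moment U s g : \bar R :=
  ereal_sup [set ((2 * burau_norm t g) `^ s)%:E | t in U].

Lemma sup_moment_ub U s g t : U t -> ((2 * burau_norm t g) `^ s)%:E <= sup_moment U s g.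
Proof. by move=> Ut; apply: ereal_sup_ubound; exists t. Qed.

Lemma sup_moment_ge0 U s g : U !=set0 -> 0 <= sup_moment U s g.
Proof.
move=> [t Ut]; apply: le_trans (sup_moment_ub s g Ut).
by rewrite lee_fin powR_ge0.
Qed.

Lemma sup_momentM U s g h : (0 <= s)%R -> poly_burau g -> poly_burau h ->
  sup_moment U s (g * h)%g <= sup_moment U s g * sup_moment U s h.
Proof.
move=> s0 Pg Ph; apply: ge_ereal_sup => _ [t Ut <-].
apply: (@le_trans _ _ (((2 * burau_norm t g) `^ s)%:E * ((2 * burau_norm t h) `^ s)%:E)).
  rewrite -EFinM lee_fin -powRM ?mulr_ge0 ?burau_norm_ge0//.
  by apply: ge0_ler_powR; rewrite ?nnegrE ?mulr_ge0 ?burau_norm_ge0// burau_normM.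
by apply: lee_pmul; rewrite ?lee_fin ?powR_ge0// sup_moment_ub.
Qed.

Lemma sup_moment_le U s g (w : R) : (0 <= s)%R ->
  (forall t, U t -> burau_norm t g <= w)%R -> sup_moment U s g <= ((2 * w) `^ s)%:E.
Proof.
move=> s0 gw; apply: ge_ereal_sup => _ [t /gw tw <-]; rewrite lee_fin.
have w0 : (0 <= w)%R by apply: le_trans tw; exact: burau_norm_ge0.
apply: ge0_ler_powR; rewrite ?nnegrE ?mulr_ge0 ?burau_norm_ge0//.
by rewrite ler_wpM2l.
Qed.

Variable mu : probability Br3 R.
Hypotheses (mu_finite : finite_set (supp mu)) (mu_poly : supp mu `<=` poly_burau).

Lemma moment_submultiplicative U s m n : (0 <= s)%R -> U !=set0 ->
  \int[conv_pow mu (m + n)]_g sup_moment U s g <=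
  \int[conv_pow mu m]_g sup_moment U s g * \int[conv_pow mu n]_g sup_moment U s g.
Proof.
move=> s0 U0; have F0 g := sup_moment_ge0 s g U0.
have [Tm [_ Pm Tm0]] := conv_pow_support m mu_finite mu_poly.
have [Tn [_ Pn Tn0]] := conv_pow_support n mu_finite mu_poly.
rewrite integral_conv_powD// muleC -ge0_integralZl//; last exact: integral_ge0.
apply: ae_ge0_le_integral => //.
- by move=> g _; exact: integral_ge0.
- by move=> g _; apply: mule_ge0 => //; exact: integral_ge0.
apply: (ae_of_full_set Tm0) => g /Pm Pg; rewrite muleC -ge0_integralZl//.
apply: ae_ge0_le_integral => //; first by move=> h _; exact: mule_ge0.
by apply: (ae_of_full_set Tn0) => h /Pn Ph; exact: sup_momentM.
Qed.

(** A divergent sequence would have the default value [0] as its limit, so the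
    sequence of means converges to a negative limit; the unnormalised integrals
    then tend to [-oo]. *)
Lemma lyapunov_lt0_integral t : lyapunov mu t < 0 ->
  exists m, \int[conv_pow mu m]_g lne (burau_norm t g)%:E < (-2)%:E.
Proof.
rewrite /lyapunov; set u := fun n => _ => u0.
have /cvg_ex[l ul] : cvgn u.
  by apply: contrapT => /dvgP ul; move: u0; rewrite ul ltxx.
move: u0; rewrite (cvg_lim _ ul)// => l0.
have [e [e0 le]] : exists e : R, (0 < e)%R /\ l < (- e)%:E.
  move: l0 {ul}; case: l => [r| |]//; last by exists 1%R; rewrite ltNyr.
  by rewrite lte_fin => r0; exists (- r / 2)%R; rewrite lte_fin; split; lra.
have un : \forall n \near \oo, u n < (- e)%:E.
  exact: (ul _ (open_ereal_lt' le)).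
have en : \forall n \near \oo, (2 / e <= n%:R)%R by exact: nbhs_infty_ger.
have [n [{}un {}en]] := filter_ex (filterI un en); exists n.
have n0 : (0 < n%:R :> R)%R by apply: lt_le_trans en; rewrite divr_gt0.
move: un; rewrite /u; case: (integral _ _ _) => [r| |]; rewrite ?ltNyr//.
  rewrite -EFinM !lte_fin ltr_pdivrMl// => h; apply: lt_le_trans h _.
  by move: en; rewrite ler_pdivrMr//; lra.
by rewrite gt0_muley ?lte_fin ?invr_gt0.
Qed.

(** At [z0] some convolution power has a moment below one, with room to spare. Only
    finitely many braids enter, so the bound persists for the supremum over a
    small ball. Submultiplicativity turns this one bound into summability over
    all times; it needs the moments at times [0] and [1] to be finite, which is
    why the ball also controls the identity and the support of [mu]. *)
Lemma moments_summable_near (z0 : R * R) : (Normc.normc (cplx z0) < 1)%R ->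
  lyapunov mu (cplx z0) < 0 ->
  exists r s : R, [/\ (0 < r)%R, (0 < s)%R,
    forall z, ball z0 r z -> (Normc.normc (cplx z) < 1)%R &
    \sum_(0 <= n <oo) \int[conv_pow mu n]_g sup_moment (@cplx R @` ball z0 r) s g < +oo].
Proof.
move=> z01 /lyapunov_lt0_integral[m mneg].
have [T [fT PT T0]] := conv_pow_support m mu_finite mu_poly.
have [s [w [s0 vw sw]]] := exp_moment_lt1 fT T0 (burau_norm_ge0 (cplx z0)) mneg.
have near1 : \forall z \near z0, (Normc.normc (cplx z) < 1)%R.
  have := @near_normc_int_eval_lt R 'X z0 1; rewrite int_evalX => /(_ z01) near_z1.
  by apply: near_subset near_z1 => z; rewrite int_evalX.
(* The braids that the ball has to control. *)
pose T' := T `|` supp mu `|` [set 1%g].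
have fT' : finite_set T' by rewrite !finite_setU.
have nearw : \forall z \near z0, forall g, T' g -> (burau_norm (cplx z) g < w g)%R.
  by apply: near_forall_finite => // g _; exact: near_burau_norm_lt.
have [r /= r0 rball] := (nbhs_ballP _ _).1 (filterI near1 nearw).
exists r, s; split=> // [z /rball[]//|].
set U := _ @` _.
have U0 : U !=set0 by exists (cplx z0), z0 => //; exact: ballxx.
have s0' := ltW s0.
have Fw g : T' g -> sup_moment U s g <= ((2 * w g) `^ s)%:E.
  by move=> Tg; apply: sup_moment_le => // _ [z /rball[_ /(_ g Tg)/ltW zw] <-].
have F0 g := sup_moment_ge0 s g U0.
pose a n := \int[conv_pow mu n]_g sup_moment U s g.
have a0 n : 0 <= a n by exact: integral_ge0.
have aM n k : a (n + k)%N <= a n * a k by exact: moment_submultiplicative.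
have a_fin n : a n \is a fin_num.
  rewrite ge0_fin_numE//; elim: n => [|n IH].
    rewrite /a integral_conv_pow0; apply: le_lt_trans (Fw _ _) _; last exact: ltry.
    by right.
  rewrite -addn1; apply: le_lt_trans (aM _ _) _.
  apply: lte_mul_pinfty => //; first by rewrite ge0_fin_numE.
  rewrite /a integral_conv_pow1//; apply: (integral_finite_lty mu_finite) => //.
    exact: supp_full.
  by move=> g Sg; apply: le_lt_trans (Fw _ _) _; [left; right|exact: ltry].
have am1 : a m < 1.
  apply: le_lt_trans sw; apply: ae_ge0_le_integral => //.
  - by move=> g _; rewrite lee_fin powR_ge0.
  - by apply: (ae_of_full_set T0) => g Tg; apply: Fw; left; left.
have [||n|B hB] := @partial_sums_bounded R (fine \o a) m (fine (a m)).
- by rewrite -lte_fin fineK.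
- by move=> n; exact: fine_ge0.
- by rewrite -lee_fin EFinM /= !fineK.
apply: (@le_lt_trans _ _ B%:E); last exact: ltry.
apply: lime_le; first by apply: is_cvg_nneseries => n _ _; exact: a0.
apply: nearW => n; apply: le_trans (_ : (\sum_(0 <= i < n) fine (a i))%:E <= _).
  by rewrite -sumEFin; apply: lee_sum => i _; rewrite fineK.
by rewrite lee_fin.
Qed.

End moments.

(** * Consequences of summable moments *)

Section decay.
Local Open Scope ereal_scope.
Context (R : realType) (mu : probability Br3 R).
Hypotheses (mu_finite : finite_set (supp mu)) (mu_poly : supp mu `<=` poly_burau).
Variables (U : set R[i]) (s : R).
Hypotheses (s0 : (0 < s)%R) (U0 : U !=set0).
Hypothesis summable_moments :
  \sum_(0 <= n <oo) \int[conv_pow mu n]_g sup_moment U s g < +oo.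

Let moment_ge0 n : 0 <= \int[conv_pow mu n]_g sup_moment U s g.
Proof. by apply: integral_ge0 => g _; exact: sup_moment_ge0. Qed.

(** For [v > 0] one has [s log v = log (v^s) <= v^s]. *)
Lemma integral_lne_burau_le n t : U t ->
  \int[conv_pow mu n]_g lne (burau_norm t g)%:E <=
  s^-1%:E * \int[conv_pow mu n]_g sup_moment U s g.
Proof.
move=> Ut; have F0 g := sup_moment_ge0 s g U0.
rewrite -ge0_integralZl//; last by rewrite lee_fin invr_ge0 ltW.
pose L g := lne (burau_norm t g)%:E; rewrite [leLHS]integralE -/L.
apply: (@le_trans _ _ (\int[conv_pow mu n]_g L^\+ g)).
  by rewrite -[leRHS]sube0; apply: leeB => //; apply: integral_ge0.
apply: ge0_le_integral => // g _.
rewrite lee_pdivlMl//; apply: le_trans (sup_moment_ub s g Ut).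
rewrite funeposE /L; set v := burau_norm t g.
have v0 : (0 <= v)%R by exact: burau_norm_ge0.
have [vle|vgt] := lerP v 0.
  by rewrite le0_lneNy ?lee_fin// max_r ?leNye// mule0 lee_fin powR_ge0.
rewrite lne_EFin// -EFin_max -EFinM lee_fin (maxr_pMr _ _ (ltW s0)) mulr0.
rewrite ge_max powR_ge0 andbT -ln_powR.
apply: (@le_trans _ _ (v `^ s)%R); first by rewrite ltW// ln_sublinear// powR_gt0.
apply: ge0_ler_powR; rewrite ?nnegrE ?mulr_ge0//; first exact: ltW.
by rewrite mulr_natl mulr2n lerDl.
Qed.

(** The integrals are bounded uniformly in [n], hence vanish in the limit after
    division by [n]. If the limit does not exist, its default value is [0]. *)
Lemma lyapunov_le0 t : U t -> lyapunov mu t <= 0.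
Proof.
move=> Ut; rewrite /lyapunov; set u := fun n => _.
have [/cvg_ex[l ul]|/dvgP ->//] := pselect (cvgn u).
pose S := \sum_(0 <= n <oo) \int[conv_pow mu n]_g sup_moment U s g.
have Soo : S < +oo := summable_moments.
have S0 : 0 <= S by apply: nneseries_ge0 => n _ _; exact: moment_ge0.
have Sfin : S \is a fin_num by rewrite ge0_fin_numE.
pose C := (s^-1 * fine S)%R.
have uC n : u n <= (C / n%:R)%:E.
  rewrite /u mulrC !EFinM fineK//; apply: lee_wpmul2l; first by rewrite lee_fin invr_ge0.
  apply: le_trans (integral_lne_burau_le n Ut) _.
  apply: lee_wpmul2l; first by rewrite lee_fin invr_ge0 ltW.
  apply: le_trans (nneseries_lim_ge n.+1 _); last by move=> k _ _; exact: moment_ge0.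
  by rewrite big_nat_recr//= leeDr// sume_ge0.
have C0 : (0 <= C)%R by rewrite mulr_ge0 ?invr_ge0 ?fine_ge0// ltW.
apply/lee_addgt0Pr => e e0; rewrite add0e; apply: lime_le; first by apply/cvg_ex; exists l.
have large : \forall n \near \oo, (C / e < n%:R)%R by exact: nbhs_infty_gtr.
apply: filterS large => n large.
have n0 : (0 < n%:R :> R)%R by apply: le_lt_trans large; rewrite divr_ge0// ltW.
apply: le_trans (uC n) _; rewrite lee_fin ler_pdivrMr//.
by move: large; rewrite ltr_pdivrMr//; lra.
Qed.

Lemma chi_eq0 t : U t -> (Normc.normc t < 1)%R -> chi mu t = 0.
Proof.
move=> /lyapunov_le0 l0 t1; rewrite /chi.
have -> : log_plus (Normc.normc t) = 0%R by apply/max_l/ln_le0/ltW.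
exact/max_r.
Qed.

(** Under this bound [det (B_t(g) - 1)] has no zero [t] in [U]. *)
Definition contracting_braid g : Prop :=
  poly_burau g /\ forall t, U t -> (2 * burau_norm t g < 2^-1)%R.

(** The inequality of Markov for [sup_moment]. *)
Lemma conv_pow_not_contracting_le n : conv_pow mu n (~` contracting_braid) <=
  ((2^-1 `^ s)^-1)%:E * \int[conv_pow mu n]_g sup_moment U s g.
Proof.
have F0 g := sup_moment_ge0 s g U0.
have c0 : (0 < 2^-1 `^ s :> R)%R by rewrite powR_gt0.
have [T [_ PT T0]] := conv_pow_support n mu_finite mu_poly.
have C0 : 0 <= ((2^-1 `^ s)^-1)%:E :> \bar R by rewrite lee_fin invr_ge0 ltW.
rewrite -ge0_integralZl//.
apply: (@le_trans _ _ (\int[conv_pow mu n]_g (\1_(~` contracting_braid) g)%:E)).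
  by rewrite integral_indic// setIT.
apply: ae_ge0_le_integral => //.
- by move=> g _; exact: mule_ge0.
apply: (ae_of_full_set T0) => g /PT Pg.
have [gg|gg] := pselect (contracting_braid g).
  by rewrite indicE memNset//= mule_ge0.
rewrite indicE mem_set//= lee_pdivlMl// mule1.
have [t [Ut gt]] : exists t, U t /\ (2^-1 <= 2 * burau_norm t g)%R.
  apply: contrapT => h; apply: gg; split=> // t Ut.
  by rewrite ltNge; apply/negP => gt; apply: h; exists t.
apply: le_trans (sup_moment_ub s g Ut); rewrite lee_fin.
by apply: ge0_ler_powR; rewrite ?nnegrE ?mulr_ge0 ?burau_norm_ge0// ?ltW.
Qed.

Context (d : measure_display) (Omega : measurableType d) (P : probability Omega R).
Variable g : nat -> {RV P >-> Br3}.
Hypothesis g_indep : mutually_independent g.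
Hypothesis g_law : forall (i : nat) (A : set Br3), distribution P (g i) A = mu A.

(** The lemma of Borel and Cantelli, the probabilities being summable by the
    inequality of Markov. *)
Lemma ae_eventually_contracting :
  {ae P, forall omega, \forall n \near \oo, contracting_braid (random_walk g n omega)}.
Proof.
pose E n := random_walk g n @^-1` (~` contracting_braid).
have mE n : measurable (E n) by exact: measurable_random_walk.
have PE n : P (E n) <=
    ((2^-1 `^ s)^-1)%:E * \int[conv_pow mu n]_h sup_moment U s h.
  by rewrite /E (random_walk_law g_indep g_law) conv_pow_not_contracting_le.
exists (lim_sup_set E); split.
- by apply: bigcap_measurable => // k _; exact: bigcup_measurable.
- apply: lim_sup_set_cvg0 => //; apply: le_lt_trans (lee_nneseries _ _) _.
  + by move=> n _ _; exact: measure_ge0.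
  + by move=> n _; exact: PE.
  rewrite nneseriesZl; last by move=> n _; exact: moment_ge0.
  by apply: lte_mul_pinfty.
move=> omega /= h n _ /=; apply: contrapT => hn; apply: h; exists n => // k /= nk.
by apply: contrapT => hk; apply: hn; exists k.
Qed.

End decay.

(** * A smooth function that is flat at the origin *)

Section flat_function.
Variable R : realType.
Implicit Types (p : {poly R}) (x : R).

(** Coefficient by coefficient, from [y^i <= i! e^y]. *)
Lemma horner_expRN_bounded p : exists C, 0 <= C /\
  forall y, 0 <= y -> `|p.[y]| * expR (- y) <= C.
Proof.
exists (\sum_(i < size p) `|p`_i| * i`!%:R); split.
  by apply: sumr_ge0 => i _; rewrite mulr_ge0.
move=> y y0; rewrite expRN ler_pdivrMr ?expR_gt0// horner_coef mulr_suml.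
apply: le_trans (ler_norm_sum _ _ _) _; apply: ler_sum => i _.
rewrite normrM -mulrA ler_wpM2l// normrX (ger0_norm y0).
have f0 : 0 < i`!%:R :> R by rewrite ltr0n fact_gt0.
rewrite -ler_pdivrMl// mulrC; case: (nat_of_ord i) => [|n].
  by rewrite expr0 fact0 divr1; have := expR_ge1Dx y; lra.
by apply: le_trans (expR_ge1Dxn n y0); rewrite lerDr.
Qed.

(** The functions [p(1/x) exp(-1/x)], extended by zero to [x <= 0]. Keeping an
    arbitrary polynomial factor makes the family stable under derivation, so that
    smoothness follows by induction. *)
Definition flat p x : R := if 0 < x then p.[x^-1] * expR (- x^-1) else 0.

Definition flat_der p : {poly R} := 'X^2 * (p - p^`()).

(** Away from the origin this is a computation. At the origin the difference
    quotient is [(1/h) p(1/h) exp(-1/h)] for [h > 0], which is [O(h)] because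
    [(1/h)^2 p(1/h) exp(-1/h)] is bounded. *)
Lemma is_derive_flat p x : is_derive x 1 (flat p) (flat (flat_der p) x).
Proof.
have [x0|x0|<-] := ltgtP 0 x.
- have E : \forall y \near x, p.[y^-1] * expR (- y^-1) = flat p y.
    near=> y; rewrite /flat ifT//; near: y; exact: lt_nbhsr.
  apply: (near_eq_is_derive E).
  have xn0 : x != 0 by rewrite gt_eqF.
  have dV : is_derive x 1 (fun y : R => y^-1) (- x ^- 2).
    apply: (is_derive_eq (is_deriveV (f := id) xn0 (is_derive_id x 1))).
    by rewrite /GRing.scale/= mulr1.
  have dP := is_derive1_comp (is_derive_poly p x^-1) dV.
  have dN : is_derive x 1 (fun y : R => - y^-1) (x ^- 2).
    by apply: (is_derive_eq (is_deriveN dV)); rewrite opprK.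
  have dE := @is_derive1_comp R expR (fun y => - y^-1) x _ _ (is_derive_expR _) dN.
  apply: (is_derive_eq (is_deriveM dP dE)).
  rewrite /flat x0 /flat_der /= /GRing.scale/= !hornerE -exprVn.
  have key (a b c y : R) : b * a * y ^+ 2 + a * c * (- y ^+ 2) = y ^+ 2 * (b - c) * a by ring.
  exact: key.
- rewrite /flat ifF; last by apply/negbTE; rewrite -leNgt ltW.
  have E : \forall y \near x, cst 0 y = flat p y.
    near=> y; rewrite /flat ifF//; apply/negbTE; rewrite -leNgt ltW//.
    near: y; exact: lt_nbhsl.
  apply: (near_eq_is_derive E); exact: is_derive_cst.
rewrite {2}/flat ltxx.
have [C [C0 hC]] := horner_expRN_bounded ('X^2 * p).
have lim0 : h^-1 *: ((flat p \o shift 0) (h *: (1 : R)) - flat p 0) @[h --> 0^'] --> (0 : R).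
  apply/cvgr0Pnorm_lt => e e0.
  near=> h.
  rewrite /= /GRing.scale /= mulr1 addr0 {2}/flat ltxx subr0 /flat.
  case: ifPn => h0; last by rewrite mulr0 normr0.
  apply: (@le_lt_trans _ _ (C * h)).
    have := hC h^-1; rewrite invr_ge0 => /(_ (ltW h0)).
    rewrite hornerM hornerXn normrM normrX (gtr0_norm (x := h^-1)) ?invr_gt0//.
    rewrite !normrM (gtr0_norm (x := h^-1)) ?invr_gt0// (ger0_norm (expR_ge0 _)).
    rewrite -ler_pdivrMr// => H; apply: le_trans H; rewrite expr2; lra.
  have he : `|h| < e / (C + 1).
    near: h; apply: dnbhs0_lt; rewrite divr_gt0//; lra.
  move: he; rewrite (gtr0_norm h0) ltr_pdivlMr; nra.
by apply: DeriveDef; [apply/cvg_ex; exists 0|exact/cvg_lim].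
Unshelve. all: by end_near.
Qed.

End flat_function.

(** * Bump functions of the plane *)

Section planar_smoothness.
Variable R : realType.
Implicit Types (p : {poly R}) (e a x : R) (z : R * R) (f g : R * R -> R).

Lemma flat_zero x : flat (0 : {poly R}) x = 0.
Proof. by rewrite /flat horner0 mul0r if_same. Qed.

Lemma is_derive_flat_affine p e a x :
  is_derive x 1 (fun y => flat p (e * y + a)) (flat (e *: flat_der p) (e * x + a)).
Proof.
have dA : is_derive x 1 (fun y : R => e * y + a) e.
  apply: (is_derive_eq (is_deriveD (is_deriveZ e (is_derive_id x 1)) (is_derive_cst a x 1))).
  by rewrite /GRing.scale/= mulr1 addr0.
have := @is_derive1_comp R (flat p) (fun y => e * y + a) x _ _ (is_derive_flat p _) dA.
move=> d; apply: (is_derive_eq d).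
by rewrite /flat; case: ifP => _; rewrite ?mul0r// hornerZ; ring.
Qed.

Lemma flat_affine_continuous p e a : continuous (fun x : R => flat p (e * x + a)).
Proof.
move=> x; apply: differentiable_continuous; apply/derivable1_diffP.
by have [] := is_derive_flat_affine p e a x.
Qed.

(** The difference quotient in the direction [(1, 0)] is literally that of [F]. *)
Lemma is_derive_fst (F : R -> R) z (dF : R) : is_derive z.1 1 F dF ->
  is_derive z (1, 0) (fun w : R * R => F w.1) dF.
Proof.
move=> [dv <-].
have E : (fun h : R => h^-1 *: (((fun w : R * R => F w.1) \o shift z)
      (h *: ((1, 0) : R * R)) - F z.1))
   = (fun h : R => h^-1 *: ((F \o shift z.1) (h *: (1 : R)) - F z.1)) by [].
by apply: DeriveDef; rewrite /derivable /derive E.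
Qed.

Lemma is_derive_fst0 (F : R -> R) z :
  is_derive z (0, 1) (fun w : R * R => F w.1) 0.
Proof.
have E : (fun h : R => h^-1 *: (((fun w : R * R => F w.1) \o shift z)
      (h *: ((0, 1) : R * R)) - F z.1))
   = (fun h : R => 0).
  by apply/funext => h; rewrite /= scaler0 add0r subrr scaler0.
apply: DeriveDef; rewrite /derivable /derive E; first exact: is_cvg_cst.
exact: lim_cst.
Qed.

Lemma is_derive_snd (F : R -> R) z (dF : R) : is_derive z.2 1 F dF ->
  is_derive z (0, 1) (fun w : R * R => F w.2) dF.
Proof.
move=> [dv <-].
have E : (fun h : R => h^-1 *: (((fun w : R * R => F w.2) \o shift z)
      (h *: ((0, 1) : R * R)) - F z.2))
   = (fun h : R => h^-1 *: ((F \o shift z.2) (h *: (1 : R)) - F z.2)) by [].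
by apply: DeriveDef; rewrite /derivable /derive E.
Qed.

Lemma is_derive_snd0 (F : R -> R) z :
  is_derive z (1, 0) (fun w : R * R => F w.2) 0.
Proof.
have E : (fun h : R => h^-1 *: (((fun w : R * R => F w.2) \o shift z)
      (h *: ((1, 0) : R * R)) - F z.2))
   = (fun h : R => 0).
  by apply/funext => h; rewrite /= scaler0 add0r subrr scaler0.
apply: DeriveDef; rewrite /derivable /derive E; first exact: is_cvg_cst.
exact: lim_cst.
Qed.

(** The other partial derivative is again of the same form, with the zero
    polynomial. *)
Lemma Ck_flat_fst k p e a : Ck k (fun z : R * R => flat p (e * z.1 + a)).
Proof.
elim: k p => [|k IH] p.
  move=> z; apply: (@continuous_comp _ _ _ fst (fun x => flat p (e * x + a))).
    exact: cvg_fst.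
  exact: flat_affine_continuous.
have d1 z := is_derive_fst (is_derive_flat_affine p e a z.1).
have d2 z := is_derive_fst0 (fun x => flat p (e * x + a)) z.
split; first by have := IH p; case: (k) => // k' [].
- by move=> z; split; [have [] := d1 z|have [] := d2 z].
- rewrite (_ : partial1 _ = fun z => flat (e *: flat_der p) (e * z.1 + a)) //.
  by apply/funext => z; have [_ <-] := d1 z.
- rewrite (_ : partial2 _ = fun z => flat 0 (e * z.1 + a)) //.
  by apply/funext => z; rewrite flat_zero; have [_ <-] := d2 z.
Qed.

Lemma Ck_flat_snd k p e a : Ck k (fun z : R * R => flat p (e * z.2 + a)).
Proof.
elim: k p => [|k IH] p.
  move=> z; apply: (@continuous_comp _ _ _ snd (fun x => flat p (e * x + a))).
    exact: cvg_snd.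
  exact: flat_affine_continuous.
have d1 z := is_derive_snd (is_derive_flat_affine p e a z.2).
have d2 z := is_derive_snd0 (fun x => flat p (e * x + a)) z.
split; first by have := IH p; case: (k) => // k' [].
- by move=> z; split; [have [] := d2 z|have [] := d1 z].
- rewrite (_ : partial1 _ = fun z => flat 0 (e * z.2 + a)) //.
  by apply/funext => z; rewrite flat_zero; have [_ <-] := d2 z.
- rewrite (_ : partial2 _ = fun z => flat (e *: flat_der p) (e * z.2 + a)) //.
  by apply/funext => z; have [_ <-] := d1 z.
Qed.

Lemma derivable_add f g z v : derivable f z v -> derivable g z v ->
  derivable (fun w => f w + g w) z v.
Proof. by move=> df dg; have := derivableD df dg; rewrite addrfctE. Qed.

Lemma derive_add f g z v : derivable f z v -> derivable g z v ->
  'D_v (fun w => f w + g w) z = 'D_v f z + 'D_v g z.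
Proof. by move=> df dg; have := deriveD df dg; rewrite addrfctE. Qed.

Lemma derivable_mul f g z v : derivable f z v -> derivable g z v ->
  derivable (fun w => f w * g w) z v.
Proof. by move=> df dg; have := derivableM df dg; rewrite mulrfctE. Qed.

Lemma derive_mul f g z v : derivable f z v -> derivable g z v ->
  'D_v (fun w => f w * g w) z = f z * 'D_v g z + g z * 'D_v f z.
Proof. by move=> df dg; have := deriveM df dg; rewrite mulrfctE. Qed.

Lemma CkW k f : Ck k.+1 f -> Ck k f.
Proof.
elim: k f => [|k IH] f; first by case.
by move=> [cf df /IH f1 /IH f2]; split.
Qed.

Lemma CkD k f g : Ck k f -> Ck k g -> Ck k (fun z => f z + g z).
Proof.
elim: k f g => [|k IH] f g.
  by move=> cf cg z; apply: cvgD; [exact: cf|exact: cg].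
move=> [cf df f1 f2] [cg dg g1 g2]; split.
- by move=> z; apply: cvgD; [exact: cf|exact: cg].
- by move=> z; have [? ?] := df z; have [? ?] := dg z; split; exact: derivable_add.
- rewrite (_ : partial1 _ = fun z => partial1 f z + partial1 g z); first exact: IH.
  by apply/funext => z; have [? ?] := df z; have [? ?] := dg z; exact: derive_add.
- rewrite (_ : partial2 _ = fun z => partial2 f z + partial2 g z); first exact: IH.
  by apply/funext => z; have [? ?] := df z; have [? ?] := dg z; exact: derive_add.
Qed.

Lemma CkM k f g : Ck k f -> Ck k g -> Ck k (fun z => f z * g z).
Proof.
elim: k f g => [|k IH] f g.
  by move=> cf cg z; apply: cvgM; [exact: cf|exact: cg].
move=> Cf Cg; have [cf df f1 f2] := Cf; have [cg dg g1 g2] := Cg; split.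
- by move=> z; apply: cvgM; [exact: cf|exact: cg].
- by move=> z; have [? ?] := df z; have [? ?] := dg z; split; exact: derivable_mul.
- rewrite (_ : partial1 _ = fun z => f z * partial1 g z + g z * partial1 f z).
    by apply: CkD; apply: IH => //; exact: CkW.
  by apply/funext => z; have [? ?] := df z; have [? ?] := dg z; exact: derive_mul.
- rewrite (_ : partial2 _ = fun z => f z * partial2 g z + g z * partial2 f z).
    by apply: CkD; apply: IH => //; exact: CkW.
  by apply/funext => z; have [? ?] := df z; have [? ?] := dg z; exact: derive_mul.
Qed.

(** A product of four flat functions, one for each side of the square of centre [c]
    and half-side [r], which is the ball of [R * R]. *)
Definition plane_bump (c : R * R) (r : R) z : R :=
  flat 1 (1 * z.1 + (r - c.1)) * flat 1 (-1 * z.1 + (r + c.1)) *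
  (flat 1 (1 * z.2 + (r - c.2)) * flat 1 (-1 * z.2 + (r + c.2))).

Lemma Ck_plane_bump k c r : Ck k (plane_bump c r).
Proof.
by do !apply: CkM; [exact: Ck_flat_fst|exact: Ck_flat_fst|
  exact: Ck_flat_snd|exact: Ck_flat_snd].
Qed.

Lemma flat_one_ge0 x : 0 <= flat 1 x.
Proof. by rewrite /flat; case: ifP => _//; rewrite hornerC mul1r expR_ge0. Qed.

Lemma flat_one_neq0 x : (flat 1 x != 0) = (0 < x).
Proof.
rewrite /flat; case: ifP => _; last by rewrite eqxx.
by rewrite hornerC mul1r gt_eqF// expR_gt0.
Qed.

Lemma plane_bump_ge0 c r z : 0 <= plane_bump c r z.
Proof. by rewrite !mulr_ge0 ?flat_one_ge0. Qed.

Lemma ball_planeE c r z : ball c r z <-> `|c.1 - z.1| < r /\ `|c.2 - z.2| < r.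
Proof. by []. Qed.

Lemma plane_bump_neq0 c r z : plane_bump c r z != 0 <-> ball c r z.
Proof.
rewrite ball_planeE /plane_bump !mulf_eq0 !negb_or !flat_one_neq0 !ltr_norml; split.
  by move=> /andP[/andP[? ?] /andP[? ?]]; split; apply/andP; split; lra.
by move=> [/andP[? ?] /andP[? ?]]; repeat (apply/andP; split); lra.
Qed.

Lemma plane_bump_support c r : [set z | plane_bump c r z != 0] = ball c r.
Proof. by apply/seteqP; split=> z /plane_bump_neq0. Qed.

Lemma test_function_plane_bump c r : test_function (plane_bump c r).
Proof.
split=> [k|]; first exact: Ck_plane_bump.
rewrite plane_bump_support.
pose B := `[c.1 - r, c.1 + r]%classic `*` `[c.2 - r, c.2 + r]%classic.
have cB : compact B by apply: compact_setX; exact: segment_compact.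
apply: (subclosed_compact (@closed_closure _ _) cB).
have clB : closed B.
  by apply: compact_closed => //; exact: norm_hausdorff.
rewrite [X in _ `<=` X]((closure_id B).1 clB); apply: closure_subset => z /ball_planeE.
rewrite !ltr_norml => -[/andP[? ?] /andP[? ?]].
by split; rewrite /= in_itv/=; apply/andP; split; lra.
Qed.

Lemma derive_eq0_open (O : set (R * R)) f (v : R * R) : open O ->
  (forall z, O z -> f z = 0) -> forall z, O z -> 'D_v f z = 0.
Proof.
move=> oO f0 z Oz; rewrite -[RHS](derive_cst (0 : R) z v).
apply: near_eq_derive; apply: filterS (open_nbhs_nbhs (conj oO Oz)) => w /f0 ->.
by [].
Qed.

(** Outside the closure of the support all derivatives vanish, and that closure is
    contained in the ball of double radius. *)
Lemma laplacian_plane_bump_eq0 c r z : 0 < r -> ~ ball c (r + r) z ->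
  laplacian (plane_bump c r) z = 0.
Proof.
move=> r0 far; pose O := ~` closure (ball c r).
have Oz : O z.
  move=> /(_ (ball z r) (nbhsx_ballx z r r0)) [w [cw zw]]; apply: far.
  exact: ball_triangle cw (ball_sym zw).
have oO : open O by apply: closed_openC; exact: closed_closure.
have b0 w : O w -> plane_bump c r w = 0.
  by apply: contra_notP => /eqP /plane_bump_neq0 cw; exact: subset_closure.
have D (v : R * R) : 'D_v (fun w => 'D_v (plane_bump c r) w) z = 0.
  exact: (derive_eq0_open v oO (derive_eq0_open v oO b0)).
exact: etrans (congr2 +%R (D (1, 0)) (D (0, 1))) (addr0 0).
Qed.

End planar_smoothness.

(** * Measures of the plane, and the theorem *)

Section covering.
Variable R : realType.

Lemma compact_ball_cover (K : set (R * R)) (r : R * R -> R) : compact K ->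
  (forall z, K z -> 0 < r z) ->
  exists D : {fset R * R}, (forall z, z \in D -> K z) /\
    forall z, K z -> exists2 c, c \in D & ball c (r c) z.
Proof.
move=> cK r0.
(* A base point, which the covering form of compactness requires. *)
pose T : ptopologicalType := HB.pack_for ptopologicalType (R * R)%type
  (isPointed.Build (R * R)%type (0, 0)).
have : @cover_compact T K by rewrite -compact_cover.
move=> {}cK.
have [] := cK (R * R)%type K (fun z => interior (ball z (r z))).
- by move=> z _; exact: open_interior.
- by move=> z Kz; exists z => //; apply: nbhsx_ballx; exact: r0.
move=> D DK KD; exists D; split=> [z /DK/set_mem//|z /KD[c cD cz]].
by exists c => //; exact: interior_subset cz.
Qed.

End covering.

Section plane_measures.
Variable R : realType.

Lemma measurable_plane_ball (c : R * R) (r : R) : measurable (ball c r : set (R * R)).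
Proof.
rewrite (_ : ball c r = ball c.1 r `*` ball c.2 r) //.
by apply: measurableX; exact: measurable_ball.
Qed.

(** The sigma-algebra of [R * R] is generated by rectangles. A compact set is the
    intersection over [n] of finite unions of balls of radius [1 / (n + 1)]
    centred in it, and balls are squares. *)
Lemma measurable_plane_compact (K : set (R * R)) : compact K -> measurable K.
Proof.
move=> cK.
have n0 n (z : R * R) : K z -> 0 < n.+1%:R^-1 :> R by rewrite invr_gt0.
have cover n := compact_ball_cover (r := fun=> n.+1%:R^-1) cK (n0 n).
have [D hD] := choice cover.
have -> : K = \bigcap_n \bigcup_(c in [set` D n]) ball c n.+1%:R^-1.
  apply/seteqP; split=> [z Kz n _|z Dz].
    by have [_ /(_ z Kz)[c cD cz]] := hD n; exists c.
  have clK : closed K by apply: compact_closed => //; exact: norm_hausdorff.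
  rewrite ((closure_id K).1 clK) => B /nbhs_ballP[e /= e0 eB].
  have [n ne] : exists n : nat, n.+1%:R^-1 < e.
    exists (Num.bound e^-1); rewrite -[ltRHS]invrK ltf_pV2 ?posrE ?invr_gt0//.
    apply: (lt_trans (archi_boundP _)); first by rewrite invr_ge0 ltW.
    by rewrite ltr_nat.
  have [c cD cz] := Dz n I; have [DK _] := hD n.
  exists c; split; first exact: DK.
  by apply: eB; apply: ball_sym; apply: le_ball cz; exact: ltW.
apply: bigcapT_measurable => n; apply: fin_bigcup_measurable => [|c _].
  exact: finite_fset.
exact: measurable_plane_ball.
Qed.

Lemma measurable_flat_affine (p : {poly R}) (e a : R) :
  measurable_fun setT (fun x : R => flat p (e * x + a)).
Proof. by apply: continuous_measurable_fun; exact: flat_affine_continuous. Qed.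

Lemma measurable_plane_bump (c : R * R) (r : R) : measurable_fun setT (plane_bump c r).
Proof.
have m1 (e a : R) : measurable_fun setT (fun z : R * R => flat 1 (e * z.1 + a)).
  exact: (measurableT_comp (measurable_flat_affine 1 e a) measurable_fst).
have m2 (e a : R) : measurable_fun setT (fun z : R * R => flat 1 (e * z.2 + a)).
  exact: (measurableT_comp (measurable_flat_affine 1 e a) measurable_snd).
apply: measurable_funM; apply: measurable_funM;
  [exact: m1|exact: m1|exact: m2|exact: m2].
Qed.

Local Open Scope ereal_scope.

(** Tested against a bump that is positive exactly on the ball and has its support
    where [chi] vanishes, the measure gives [0]. *)
Lemma bifurcation_measure_ball0 (mu : probability Br3 R)
    (nu : {measure set (R * R) -> \bar R}) (c : R * R) (r : R) :
  is_bifurcation_measure mu nu -> (0 < r)%R ->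
  (forall z, ball c (r + r)%R z -> chi mu (cplx z) = 0) -> nu (ball c r) = 0.
Proof.
move=> [_ nuE] r0 chi0.
have : \int[nu]_z (plane_bump c r z)%:E = 0.
  rewrite (nuE _ (@test_function_plane_bump R c r)).
  rewrite (_ : (fun z => _) = cst 0) ?integral0 ?mule0//.
  apply/funext => z /=; have [/chi0 ->|far] := pselect (ball c (r + r)%R z).
    by rewrite mul0e.
  by rewrite laplacian_plane_bump_eq0// mule0.
have mb : measurable_fun setT (fun z => (plane_bump c r z)%:E).
  by apply/measurable_EFinP; exact: measurable_plane_bump.
rewrite (eq_integral (fun z => `|(plane_bump c r z)%:E|)); last first.
  by move=> z _; rewrite gee0_abs// lee_fin plane_bump_ge0.
move=> /(ae_eq_integral_abs nu measurableT mb) ae0.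
apply/(negligibleP _ (measurable_plane_ball c r)).
apply: negligibleS ae0 => z /plane_bump_neq0 bz /= h.
by have := h I; move=> /eqP; rewrite eqe; apply/negP.
Qed.

End plane_measures.

Lemma ae_forall_fset (R : realType) (d : measure_display) (Omega : measurableType d)
    (P : probability Omega R) (I : choiceType) (D : {fset I}) (Q : I -> Omega -> Prop) :
  (forall c, c \in D -> {ae P, forall omega, Q c omega}) ->
  {ae P, forall omega, forall c, c \in D -> Q c omega}.
Proof.
move=> h; have FF := ae_filter_ringOfSetsType P.
by apply: (@filterS _ _ FF _ _ _ (@filter_bigI _ _ D Q _ FF h)) => x Qx c; exact: Qx.
Qed.

Lemma eventually_forall_fset (I : choiceType) (D : {fset I}) (Q : I -> nat -> Prop) :
  (forall c, c \in D -> \forall n \near \oo, Q c n) ->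
  \forall n \near \oo, forall c, c \in D -> Q c n.
Proof.
move=> h; have FF : Filter (nbhs \oo) := eventually_filter.
by apply: (@filterS _ _ FF _ _ _ (@filter_bigI _ _ D Q _ FF h)) => x Qx c; exact: Qx.
Qed.

Local Open Scope ereal_scope.

Theorem corollary1p8 (R : realType) (mu : probability Br3 R)
    (mu_positive : mu positive_braids = 1)
    (mu_finsupp : finite_set (supp mu))
    (mu_gen : generating mu)
    (d : measure_display) (Omega : measurableType d) (P : probability Omega R)
    (g : nat -> {RV P >-> Br3})
    (g_indep : mutually_independent g)
    (g_law : forall (i : nat) (A : set Br3), distribution P (g i) A = mu A)
    (K : set R[i])
    (K_compact : compact (@cplx R @^-1` K))
    (K_sub : K `<=` [set t | (Normc.normc t < 1)%R /\ lyapunov mu t < 0]) :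
  {ae P, forall omega : Omega,
    (fun n : nat => (n%:R^-1)%:E *
       root_count (alexander (random_walk g n omega)) K) @ \oo --> 0} /\
  (forall nu : {measure set (R * R) -> \bar R},
     is_bifurcation_measure mu nu -> nu (@cplx R @^-1` K) = 0).
Proof.
have mu_poly : supp mu `<=` poly_burau.
  move=> x /negP Sx; apply: contrapT => Nx; apply: Sx.
  have pos0 : mu (~` positive_braids) = 0.
    by rewrite (probability_setC mu)// mu_positive subee.
  rewrite -measure_le0 -pos0; apply: le_measure; try exact/mem_set/braid_measurable.
  by move=> _ -> /positive_poly_burau.
pose K' := @cplx R @^-1` K.
pose locally (z : R * R) (r : R) := exists s : R, [/\ (0 < r)%R, (0 < s)%R,
    forall w, ball z r w -> (Normc.normc (cplx w) < 1)%R &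
    \sum_(0 <= n <oo) \int[conv_pow mu n]_g sup_moment (@cplx R @` ball z r) s g < +oo].
have locK z : exists r, K' z -> locally z r.
  have [Kz|NKz] := pselect (K' z); last by exists 0%R.
  have [z1 lz] := K_sub _ Kz.
  have [r [s H]] := moments_summable_near mu_finsupp mu_poly z1 lz.
  by exists r => _; exists s.
have [r locr] := choice locK.
have ball_ne z rz : (0 < rz)%R -> @cplx R @` ball z rz !=set0.
  by move=> rz0; exists (cplx z), z => //; exact: ballxx.
split; last first.
  move=> nu nu_bif; have r2 z : K' z -> (0 < r z / 2)%R.
    by move=> /locr[s [r0 _ _ _]]; rewrite divr_gt0.
  have [D [DK KD]] := compact_ball_cover K_compact r2.
  apply/(negligibleP nu (measurable_plane_compact K_compact)).
  apply: (@negligibleS _ _ _ _ (\bigcup_(c in [set` D]) ball c (r c / 2)%R)).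
    by move=> z /KD[c cD cz]; exists c.
  rewrite bigcup_fset big_seq; apply: big_ind => [|A B|c /DK Kc].
  - exact: negligible_set0.
  - exact: negligibleU.
  apply/(negligibleP nu (measurable_plane_ball _ _)).
  have [s [r0 s0 r1 sm]] := locr c Kc.
  apply: bifurcation_measure_ball0 nu_bif (r2 c Kc) _ => z.
  rewrite -splitr => cz; apply: (chi_eq0 s0 (ball_ne _ _ r0) sm _ (r1 z cz)).
  by exists z.
have r0 z : K' z -> (0 < r z)%R by move=> /locr[s []].
have [D [DK KD]] := compact_ball_cover K_compact r0.
have good c : c \in D -> {ae P, forall omega, \forall n \near \oo,
    contracting_braid (@cplx R @` ball c (r c)) (random_walk g n omega)}.
  move=> /DK Kc; have [s [rc0 s0 _ sm]] := locr c Kc.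
  exact: (ae_eventually_contracting mu_finsupp mu_poly s0 (ball_ne _ _ rc0) sm g_indep g_law).
apply: filterS (ae_forall_fset good) => omega /eventually_forall_fset h.
apply: cvg_near_cst; apply: filterS h => n h.
have -> : root_count (alexander (random_walk g n omega)) K = 0; last by rewrite mule0.
(* If [K] is empty, so is the cover, and nothing is known about the walk. *)
have [->|/set0P[t0 Kt0]] := eqVneq K set0; first exact: esum_set0.
have in_ball t : K t -> exists2 c, c \in D & (@cplx R @` ball c (r c)) t.
  case: t => x y Kxy; have [c cD cz] := KD (x, y) Kxy.
  by exists c => //; exists (x, y).
apply: root_count_eq0 => [|t /in_ball[c cD ct]].
  by have [c cD _] := in_ball _ Kt0; have [] := h c cD.
by have [_] := h c cD; apply.
Qed.
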